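(* Let $(C,\mathbf A)$, with $C\in\mathcal L(\mathcal X,\mathcal Y)$ and $\mathbf A=(A_1,\dots,A_d)\in\mathcal L(\mathcal X)^d$, be a contractive pair, let $$\mathcal D=\overline{\operatorname{span}}\{Z(\zeta)^*(I-A^*Z(\zeta)^* )^{-1}C^*y:\ \zeta\in\mathbb B^d,\ y\in\mathcal Y\}\subset\mathcal X^d,$$ and let $T:=[A^*|_{\mathcal D}\ \ C^*]:\mathcal D\oplus\mathcal Y\to\mathcal X$. (1) Given a Hilbert space $\mathcal U$, there exists an $S\in\mathcal S_d(\mathcal U,\mathcal Y)$ such that $$K_S(\lambda,\zeta)=K_{C,\mathbf A}(\lambda,\zeta)\qquad(\lambda,\zeta\in\mathbb B^d)\qquad(\ast)$$ if and only if $$\dim\mathcal U\ge\dim\overline{\operatorname{Ran}}\,(I-T^*T)^{1/2}.\qquad(\ast\ast)$$ (2) If $(\ast\ast)$ is satisfied, then all $S\in\mathcal S_d(\mathcal U,\mathcal Y)$ for which $(\ast)$ holds are described by the formula $$S(\lambda)=\begin{bmatrix}C(I-Z(\lambda)A)^{-1}Z(\lambda)&I_{\mathcal Y}\end{bmatrix}(I-T^*T)^{1/2}G^*,$$ where $G$ is an isometry from $\overline{\operatorname{Ran}}\,(I-T^*T)^{1/2}$ onto $\operatorname{Ran}G\subset\mathcal U$. (3) If $\dim\mathcal U=\dim\overline{\operatorname{Ran}}\,(I-T^*T)^{1/2}$, then the function $S\in\mathcal S_d(\mathcal U,\mathcal Y)$ such that $(\ast)$ holds is defined uniquely up to a constant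 unitary factor on the right.
   Context: $\mathcal U,\mathcal Y,\mathcal X$ are Hilbert spaces and $\mathcal L(\cdot,\cdot)$ denotes bounded linear operators. $\mathbb B^d$ is the open unit ball of $\mathbb C^d$ with inner product $\langle\lambda,\zeta\rangle=\sum_j\lambda_j\overline{\zeta_j}$; $\mathcal H(k_d)$ is the reproducing kernel Hilbert space on $\mathbb B^d$ with kernel $k_d(\lambda,\zeta)=1/(1-\langle\lambda,\zeta\rangle)$ and $\mathcal H_{\mathcal Y}(k_d)=\mathcal H(k_d)\otimes\mathcal Y$, viewed as a space of $\mathcal Y$-valued functions. $\mathcal S_d(\mathcal U,\mathcal Y)$ is the set of $\mathcal L(\mathcal U,\mathcal Y)$-valued analytic functions $S$ on $\mathbb B^d$ such that $f\mapsto S f$ is a contraction from $\mathcal H_{\mathcal U}(k_d)$ into $\mathcal H_{\mathcal Y}(k_d)$. Put $K_S(\lambda,\zeta)=\dfrac{I_{\mathcal Y}-S(\lambda)S(\zeta)^*}{1-\langle\lambda,\zeta\rangle}$. The pair $(C,\mathbf A)$ is contractive if $A_1^*A_1+\cdots+A_d^*A_d+C^*C\le I_{\mathcal X}$. Put $$K_{C,\mathbf A}(\lambda,\zeta)=C(I-\lambda_1A_1-\cdots-\lambda_dA_d)^{-1}(I-\overline{\zeta_1}A_1^*-\cdots-\overline{\zeta_d}A_d^* )^{-1}C^* .$$ $A:\mathcal X\to\mathcal X^d$ is the column operator with entries $A_1,\dots,A_d$, and $Z(\lambda)=[\lambda_1I_{\mathcal X}\ \cdots\ \lambda_dI_{\mathcal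 X}]:\mathcal X^d\to\mathcal X$. In the formula of part (2), the row operator acts on $\mathcal D\oplus\mathcal Y\subset\mathcal X^d\oplus\mathcal Y$ and $G^*:\mathcal U\to\overline{\operatorname{Ran}}\,(I-T^*T)^{1/2}\subset\mathcal D\oplus\mathcal Y$. Dimension means Hilbert space dimension.
   Formalization: Part (3) is false when the common dimension is infinite (X=0, Y=U=ℓ²: S=I and S=backward shift both solve (∗)); it is proved for finite dim U, and in general only for the solutions whose G in the formula of part (2) is unitary. *)

(* Defs.v *)
From HB Require Import structures.
From mathcomp Require Import all_boot all_order all_algebra complex.
From mathcomp Require Import all_classical all_reals.
From mathcomp Require Import topology normedtype.
Set Implicit Arguments.
Unset Strict Implicit.
Unset Printing Implicit Defensive.
Import Order.TTheory GRing.Theory Num.Theory.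
Import numFieldNormedType.Exports.
Local Open Scope classical_set_scope.
Local Open Scope card_scope.
Local Open Scope ring_scope.


Section dot_norm.
Context (K : numClosedFieldType) (V : lmodType K) (dot : V -> V -> K).
Hypothesis dot_linearl : forall (a : K) (x y z : V),
  dot (a *: x + y) z = a * dot x z + dot y z.
Hypothesis dotC : forall x y : V, dot x y = (dot y x)^*.
Hypothesis dot_ge0 : forall x : V, 0 <= dot x x.
Hypothesis dot_eq0 : forall x : V, dot x x = 0 -> x = 0.

Let dotDl x y z : dot (x + y) z = dot x z + dot y z.
Proof. by have := dot_linearl 1 x y z; rewrite scale1r mul1r. Qed.
Let dot0l z : dot 0 z = 0.
Proof.
have := dotDl 0 0 z; rewrite addr0 => /esym/eqP.
by rewrite -subr_eq0 addrK => /eqP.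
Qed.
Let dotZl a x z : dot (a *: x) z = a * dot x z.
Proof. by have := dot_linearl a x 0 z; rewrite !addr0 dot0l addr0. Qed.
Let dotDr x y z : dot x (y + z) = dot x y + dot x z.
Proof. by rewrite dotC dotDl rmorphD /= -!dotC. Qed.
Let dotZr a x y : dot x (a *: y) = a^* * dot x y.
Proof. by rewrite dotC dotZl rmorphM /= -dotC. Qed.

Definition dot_norm x := sqrtC (dot x x).

Lemma dot_norm_sq x : dot_norm x ^+ 2 = dot x x. Proof. exact: sqrtCK. Qed.

Let norm_ge0 x : 0 <= dot_norm x. Proof. by rewrite sqrtC_ge0 dot_ge0. Qed.

Lemma dot_cauchy_schwarz x y : `|dot x y| <= dot_norm x * dot_norm y.
Proof.
rewrite -(@ler_pXn2r _ 2)// ?nnegrE ?mulr_ge0// exprMn !dot_norm_sq.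
have [y0|y0] := eqVneq (dot y y) 0.
  by rewrite (dot_eq0 y0) dotC !dot0l rmorph0 normr0 expr0n mulr0.
have yy : 0 < dot y y by rewrite lt_def y0 dot_ge0.
set a := dot x y / dot y y.
have ac : a * dot y y = dot x y by rewrite /a divfK.
have : 0 <= dot x x - a * dot y x.
  have := dot_ge0 (x + (- a) *: y).
  rewrite dotDl !dotDr !dotZl !dotZr rmorphN /= (mulrCA (- a)).
  by rewrite (mulNr a (dot y y)) ac !mulNr mulrN opprK addrACA addNr addr0.
rewrite subr_ge0 => /(ler_wpM2r (ltW yy)); apply: le_trans.
by rewrite mulrAC ac normCK -dotC.
Qed.

Lemma dot_norm_triangle x y : dot_norm (x + y) <= dot_norm x + dot_norm y.
Proof.
rewrite -(@ler_pXn2r _ 2)// ?nnegrE ?addr_ge0// dot_norm_sq sqrrD !dot_norm_sq.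
rewrite dotDl !dotDr (dotC y x) addrA lerD2r -addrA lerD2l.
have -> : dot x y + (dot x y)^* = 'Re (dot x y) *+ 2.
  by rewrite ReE -[RHS]mulr_natr divfK// pnatr_eq0.
rewrite lerMn2r /=; apply: le_trans (dot_cauchy_schwarz x y).
exact: leif_Re_Creal.
Qed.

Lemma dot_normZ a x : dot_norm (a *: x) = `|a| * dot_norm x.
Proof.
apply/eqP; rewrite -(@eqrXn2 _ 2)// ?mulr_ge0//.
by rewrite exprMn !dot_norm_sq dotZl dotZr mulrA normCK.
Qed.

Lemma dot_norm_eq0 x : dot_norm x = 0 -> x = 0.
Proof. by move=> x0; apply: dot_eq0; rewrite -dot_norm_sq x0 expr0n. Qed.
End dot_norm.

HB.mixin Record NormedModule_isInnerProduct (R : realType) V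
    & NormedModule R[i] V := {
  hdot : V -> V -> R[i] ;
  hdot_linearl : forall (a : R[i]) (x y z : V),
    hdot (a *: x + y) z = a * hdot x z + hdot y z ;
  hdotC : forall x y : V, hdot x y = (hdot y x)^* ;
  hdot_norm : forall x : V, hdot x x = `|x| ^+ 2
}.

#[short(type="preHilbertType")]
HB.structure Definition PreHilbert (R : realType) :=
  {V of NormedModule R[i] V & NormedModule_isInnerProduct R V}.

#[short(type="hilbertType")]
HB.structure Definition Hilbert (R : realType) :=
  {V of PreHilbert R V & Complete V}.

HB.factory Record Lmodule_isPreHilbert (R : realType) V & GRing.Lmodule R[i] V := {
  hdot : V -> V -> R[i] ;
  hdot_linearl : forall (a : R[i]) (x y z : V),
    hdot (a *: x + y) z = a * hdot x z + hdot y z ;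
  hdotC : forall x y : V, hdot x y = (hdot y x)^* ;
  hdot_ge0 : forall x : V, 0 <= hdot x x ;
  hdot_eq0 : forall x : V, hdot x x = 0 -> x = 0
}.

HB.builders Context R V & Lmodule_isPreHilbert R V.
HB.instance Definition _ := Lmodule_isNormed.Build R[i] V
  (dot_norm_triangle hdot_linearl hdotC hdot_ge0 hdot_eq0)
  (dot_normZ hdot_linearl hdotC hdot_ge0)
  (dot_norm_eq0 hdot_eq0).
HB.instance Definition _ := NormedModule_isInnerProduct.Build R V
  hdot_linearl hdotC (fun x => esym (dot_norm_sq hdot x)).
HB.end.


Lemma cauchy_image (K : numFieldType) (T : normedModType K)
    (V : completeNormedModType K) (f : T -> V) (F : set_system T) :
  (forall x y, `|f x - f y| <= `|x - y|) ->
  ProperFilter F -> cauchy F -> exists l : V, f @ F --> l.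
Proof.
move=> f_le FF /cauchyP Fc; apply/cvg_ex; apply: cauchy_cvg.
apply: cauchy_exP => e e0; have [x Fx] := Fc e e0.
exists (f x); rewrite nbhs_simpl/=; apply: filterS Fx => y.
by rewrite -!ball_normE/=; apply: le_lt_trans.
Qed.

(* Orthogonal direct sums: the products of the library carry the sup norm, which
   is not a Hilbert space norm. *)
Definition hsum (R : realType) (V W : hilbertType R) : Type := (V * W)%type.

Section hsum.
Context (R : realType) (V W : hilbertType R).
HB.instance Definition _ := GRing.Lmodule.copy (hsum V W) (V * W)%type.

Let dot (p q : hsum V W) : R[i] := hdot p.1 q.1 + hdot p.2 q.2.
Let dot_linearl (a : R[i]) (x y z : hsum V W) : dot (a *: x + y) z = a * dot x z + dot y z.
Proof. by rewrite /dot /= !hdot_linearl mulrDr addrACA. Qed.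
Let dotC x y : dot x y = (dot y x)^*.
Proof. by rewrite /dot rmorphD /= -!hdotC. Qed.
Let dot_ge0 x : 0 <= dot x x.
Proof. by rewrite /dot !hdot_norm addr_ge0// exprn_ge0. Qed.
Let dot_eq0 x : dot x x = 0 -> x = 0.
Proof.
move=> /eqP; rewrite /dot !hdot_norm paddr_eq0 ?exprn_ge0// !expf_eq0/= !normr_eq0.
by case: x => x1 x2 /= /andP[/eqP-> /eqP->].
Qed.
HB.instance Definition _ := Lmodule_isPreHilbert.Build R (hsum V W)
  dot_linearl dotC dot_ge0 dot_eq0.


Lemma hsum_normE (p : hsum V W) : `|p| ^+ 2 = `|p.1| ^+ 2 + `|p.2| ^+ 2.
Proof. by rewrite -!hdot_norm. Qed.
Lemma hsum_norm1 (p : hsum V W) : `|p.1| <= `|p|.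
Proof. by rewrite -(@ler_pXn2r _ 2)// ?nnegrE// hsum_normE lerDl exprn_ge0. Qed.
Lemma hsum_norm2 (p : hsum V W) : `|p.2| <= `|p|.
Proof. by rewrite -(@ler_pXn2r _ 2)// ?nnegrE// hsum_normE lerDr exprn_ge0. Qed.
Lemma hsum_norm_le (p : hsum V W) : `|p| <= `|p.1| + `|p.2|.
Proof.
rewrite -(@ler_pXn2r _ 2)// ?nnegrE ?addr_ge0// hsum_normE sqrrD lerD2r lerDl.
by rewrite mulrn_wge0// mulr_ge0.
Qed.

Let complete (F : set_system (hsum V W)) : ProperFilter F -> cauchy F -> cvg F.
Proof.
move=> FF Fc.
have [l1 Fl1] : exists l : V, (fst : hsum V W -> V) @ F --> l.
  by apply: cauchy_image => // x y; exact: (hsum_norm1 (x - y)).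
have [l2 Fl2] : exists l : W, (snd : hsum V W -> W) @ F --> l.
  by apply: cauchy_image => // x y; exact: (hsum_norm2 (x - y)).
apply/cvg_ex; exists ((l1, l2) : hsum V W).
apply/cvgrPdist_lt => e e0; have e20 : 0 < e / 2 by rewrite divr_gt0.
have F1 := cvgr_dist_lt _ _ Fl1 _ e20; have F2 := cvgr_dist_lt _ _ Fl2 _ e20.
near=> x.
apply: le_lt_trans (hsum_norm_le _) _; rewrite [ltRHS]splitr ltrD//=.
  by near: x; exact: F1.
by near: x; exact: F2.
Unshelve. all: by end_near. Qed.
HB.instance Definition _ := Uniform_isComplete.Build (hsum V W) complete.
End hsum.

Definition hpow (R : realType) (V : hilbertType R) (d : nat) : Type :=
  {ffun 'I_d -> V}.

Section hpow.
Context (R : realType) (V : hilbertType R) (d : nat).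
HB.instance Definition _ := GRing.Lmodule.copy (hpow V d) {ffun 'I_d -> V}.

Let dot (p q : hpow V d) : R[i] := \sum_j hdot (p j) (q j).
Let dot_linearl (a : R[i]) (x y z : hpow V d) :
  dot (a *: x + y) z = a * dot x z + dot y z.
Proof.
rewrite /dot mulr_sumr -big_split; apply: eq_bigr => j _ /=.
by rewrite !ffunE hdot_linearl.
Qed.
Let dotC x y : dot x y = (dot y x)^*.
Proof. by rewrite /dot rmorph_sum; apply: eq_bigr => j _; exact: hdotC. Qed.
Let dot_ge0 x : 0 <= dot x x.
Proof. by apply: sumr_ge0 => j _; rewrite hdot_norm exprn_ge0. Qed.
Let dot_eq0 x : dot x x = 0 -> x = 0.
Proof.
move=> /psumr_eq0P x0; apply/ffunP => j; rewrite ffunE; apply/eqP.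
rewrite -normr_eq0 -sqrf_eq0 -hdot_norm x0// => i _.
by rewrite hdot_norm exprn_ge0.
Qed.
HB.instance Definition _ := Lmodule_isPreHilbert.Build R (hpow V d)
  dot_linearl dotC dot_ge0 dot_eq0.

Lemma hpow_normE (p : hpow V d) : `|p| ^+ 2 = \sum_j `|p j| ^+ 2.
Proof. by rewrite -hdot_norm; apply: eq_bigr => j _; rewrite -hdot_norm. Qed.
Lemma hpow_norm_ge (p : hpow V d) j : `|p j| <= `|p|.
Proof.
rewrite -(@ler_pXn2r _ 2)// ?nnegrE// hpow_normE (bigD1 j)//= lerDl.
by apply: sumr_ge0 => i _; rewrite exprn_ge0.
Qed.
Lemma hpow_norm_le (p : hpow V d) : `|p| <= \sum_j `|p j|.
Proof.
rewrite -(@ler_pXn2r _ 2)// ?nnegrE ?sumr_ge0// hpow_normE.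
suff [] : (0 <= \sum_j `|p j|) /\
    (\sum_j `|p j| ^+ 2 <= (\sum_j `|p j|) ^+ 2) by [].
elim/big_ind2 : _ => [|x1 x2 y1 y2 [] x10 x12 [] y10 y12|j _]; last by [].
  by rewrite expr0n.
rewrite addr_ge0//; split=> //; rewrite sqrrD (le_trans (lerD x12 y12))//.
by rewrite lerD2r lerDl mulrn_wge0// mulr_ge0.
Qed.

Let complete (F : set_system (hpow V d)) : ProperFilter F -> cauchy F -> cvg F.
Proof.
move=> FF Fc.
have /choice[l Fl] : forall j, exists l : V, (fun p : hpow V d => p j) @ F --> l.
  move=> j; apply: cauchy_image => // x y.
  by have := hpow_norm_ge (x - y) j; rewrite !ffunE.
apply/cvg_ex; exists (finfun l : hpow V d).
apply/cvgrPdist_lt => e e0; near=> x.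
apply: le_lt_trans (hpow_norm_le _) _.
apply: (@le_lt_trans _ _ (\sum_(j < d) e / d.+1%:R)).
  apply: ler_sum => j _; rewrite !ffunE; apply/ltW; move: j; near: x.
  apply: filter_forall => j.
  by apply: (cvgr_dist_lt _ _ (Fl j)); rewrite divr_gt0// ltr0Sn.
rewrite sumr_const card_ord -[ltLHS]mulr_natr -mulrA gtr_pMr//.
by rewrite mulrC ltr_pdivrMr ?ltr0Sn// mul1r ltr_nat.
Unshelve. all: by end_near. Qed.
HB.instance Definition _ := Uniform_isComplete.Build (hpow V d) complete.
End hpow.

Section span.
Context (R : realType) (H : hilbertType R).

Definition lspan (A : set H) : set H :=
  [set x | exists n (c : 'I_n -> R[i]) (a : 'I_n -> H),
     (forall i, A (a i)) /\ x = \sum_i c i *: a i].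

Definition cspan (A : set H) : set H := closure (lspan A).

Lemma cspanP (A : set H) (x : H) :
  cspan A x <-> forall e : R[i], 0 < e -> exists2 y, lspan A y & `|x - y| < e.
Proof.
split=> [Ax e e0|Ax B /nbhs_ballP[e /= e0 xeB]].
  have [y [Ay xy]] := Ax _ (nbhsx_ballx x e e0).
  by exists y => //; move: xy; rewrite -ball_normE.
have [y Ay xy] := Ax e e0; exists y; split=> //.
by apply: xeB; rewrite -ball_normE.
Qed.

Lemma lspan0 (A : set H) : lspan A 0.
Proof. by exists 0%N, (fun=> 0), (fun=> 0); split; [case|rewrite big_ord0]. Qed.

Lemma lspanDZ (A : set H) (k : R[i]) (x y : H) :
  lspan A x -> lspan A y -> lspan A (k *: x + y).
Proof.
move=> [n [c [a [Aa ->]]]] [m [c' [a' [Aa' ->]]]].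
exists (n + m)%N, (fun i => match fintype.split i with inl j => k * c j | inr j => c' j end),
  (fun i => match fintype.split i with inl j => a j | inr j => a' j end).
split=> [i|]; first by case: (fintype.split i).
rewrite big_split_ord/= scaler_sumr; congr (_ + _); apply: eq_bigr => i _.
  by rewrite (unsplitK (inl i)) scalerA.
by rewrite (unsplitK (inr i)).
Qed.

Lemma cspanDZ (A : set H) (k : R[i]) (x y : H) :
  cspan A x -> cspan A y -> cspan A (k *: x + y).
Proof.
move=> /cspanP Ax /cspanP Ay; apply/cspanP => e e0.
have k0 : 0 < `|k| + 1 by rewrite ltr_wpDl.
have [x' Ax' xx'] := Ax (e / 2 / (`|k| + 1)) ltac:(by rewrite !divr_gt0).
have [y' Ay' yy'] := Ay (e / 2) ltac:(by rewrite divr_gt0).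
exists (k *: x' + y'); first exact: lspanDZ.
rewrite opprD addrACA -scalerBr (le_lt_trans (ler_normD _ _))//.
rewrite [ltRHS]splitr ler_ltD// normrZ.
rewrite (@le_trans _ _ ((`|k| + 1) * `|x - x'|))//.
  by rewrite ler_wpM2r// lerDl.
by rewrite mulrC -ler_pdivlMr// ltW.
Qed.

Lemma cspan0 (A : set H) : cspan A 0.
Proof. by apply: subset_closure; exact: lspan0. Qed.

Definition in_cspan (A : set H) : {pred H} := fun x => x \in cspan A.

Lemma cspan_submod (A : set H) : submod_closed (in_cspan A).
Proof.
split=> [|k x y]; first exact/mem_set/cspan0.
by rewrite !unfold_in => /set_mem Ax /set_mem Ay; exact/mem_set/cspanDZ.
Qed.
HB.instance Definition _ (A : set H) :=
  GRing.isSubmodClosed.Build _ _ (in_cspan A) (cspan_submod A).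

(* The closed linear span of [A], as a Hilbert space *)
Record hspan (A : set H) : Type :=
  HSpan { hspan_val :> H ; hspan_valP : hspan_val \in in_cspan A }.
End span.

Section hspan.
Context (R : realType) (H : hilbertType R) (A : set H).
HB.instance Definition _ := [isSub for @hspan_val R H A].
HB.instance Definition _ := [Choice of hspan A by <:].
HB.instance Definition _ := [SubChoice_isSubLmodule of hspan A by <:].

Let dot (x y : hspan A) : R[i] := hdot (x : H) (y : H).
Let dot_linearl (a : R[i]) (x y z : hspan A) :
  dot (a *: x + y) z = a * dot x z + dot y z.
Proof. by rewrite /dot hdot_linearl. Qed.
Let dotC x y : dot x y = (dot y x)^*.
Proof. exact: hdotC. Qed.
Let dot_ge0 x : 0 <= dot x x.
Proof. by rewrite /dot hdot_norm exprn_ge0. Qed.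
Let dot_eq0 x : dot x x = 0 -> x = 0.
Proof.
move=> /eqP; rewrite /dot hdot_norm expf_eq0/= normr_eq0 => /eqP x0.
exact/val_inj.
Qed.
HB.instance Definition _ := Lmodule_isPreHilbert.Build R (hspan A)
  dot_linearl dotC dot_ge0 dot_eq0.

Lemma hspan_normE (x : hspan A) : `|x| = `|x : H|.
Proof. by apply/eqP; rewrite -(@eqrXn2 _ 2)// -!hdot_norm. Qed.

Let complete (F : set_system (hspan A)) : ProperFilter F -> cauchy F -> cvg F.
Proof.
move=> FF Fc.
have [l Fl] : exists l : H, (@hspan_val R H A) @ F --> l.
  by apply: cauchy_image => // x y; rewrite hspan_normE.
have Al : l \in in_cspan A.
  apply/mem_set; apply: (closed_cvg (cspan A) _ _ _ Fl).
    exact: closed_closure.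
  by apply: nearW => x; exact/set_mem/hspan_valP.
apply/cvg_ex; exists (HSpan Al).
apply/cvgrPdist_lt => e e0; near=> x; rewrite hspan_normE/=.
by near: x; exact: (cvgr_dist_lt _ _ Fl).
Unshelve. all: by end_near. Qed.
HB.instance Definition _ := Uniform_isComplete.Build (hspan A) complete.
End hspan.

Record bounded_op (R : realType) (U V : hilbertType R) : Type := BoundedOp {
  op_fun :> {linear U -> V} ;
  op_continuous : continuous op_fun
}.

Notation "''L' ( U , V )" := (bounded_op U V)
  (at level 8, U at level 99, V at level 99, format "''L' ( U ,  V )") : type_scope.

Section operators.
Context (R : realType).
Implicit Types U V H : hilbertType R.

(* [adj f y] is the vector representing the functional [x |-> <f x, y>]; it
   exists, and is unique, whenever [f] is bounded and linear. *)
Definition adj U V (f : U -> V) : V -> U :=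
  fun y => xget 0 [set z | forall x, hdot (f x) y = hdot x z].

(* Only meaningful for a bijective [f]. *)
Definition op_inv V (f : V -> V) : V -> V := fun y => xget 0 [set x | f x = y].

Definition op_le H (f g : H -> H) : Prop :=
  forall x, hdot (f x) x <= hdot (g x) x.

(* The positive square root, only meaningful for a positive bounded [f]. *)
Definition op_sqrt H (f : H -> H) : H -> H :=
  xget (fun=> 0) [set q : H -> H |
    [/\ exists Q : 'L(H, H), q = Q, op_le (fun=> 0) q & forall x, q (q x) = f x]].

Definition isometric U V (f : U -> V) : Prop := forall x, `|f x| = `|x|.

Definition onto U V (f : U -> V) : Prop := forall y, exists x, f x = y.

Definition unitary U V (f : U -> V) : Prop := isometric f /\ onto f.

Definition orthonormal_set H (E : set H) : Prop :=
  forall x y, E x -> E y -> hdot x y = (x == y)%:R.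

Definition hilbert_basis H (E : set H) : Prop :=
  orthonormal_set E /\ cspan E = setT.

Definition hdim_le U V : Prop := exists (E : set U) (F : set V),
  [/\ hilbert_basis E, hilbert_basis F & E #<= F].

Definition hdim_eq U V : Prop := exists (E : set U) (F : set V),
  [/\ hilbert_basis E, hilbert_basis F & E #= F].

Definition hdim_finite U : Prop :=
  exists E : set U, hilbert_basis E /\ finite_set E.

End operators.

Definition cdot (R : realType) (d : nat) (l z : 'rV[R[i]]_d) : R[i] :=
  \sum_j l 0 j * (z 0 j)^*.

Record unit_ball (R : realType) (d : nat) : Type := UnitBall {
  ball_val :> 'rV[R[i]]_d ;
  ball_valP : cdot ball_val ball_val < 1
}.

Section multipliers.
Context (R : realType) (d : nat).
Local Notation B := (unit_ball R d).
Implicit Types (H U Y T : hilbertType R) (l z : B).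

Definition kd l z : R[i] := (1 - cdot l z)^-1.

(* [H], whose element [f] is read as the function [ev f], is the reproducing
   kernel Hilbert space of functions on the ball with kernel [k]. *)
Record is_rkhs (k : B -> B -> R[i]) H (ev : H -> B -> R[i]) : Prop := {
  rkhs_linear : forall (a : R[i]) f g l,
    ev (a *: f + g) l = a * ev f l + ev g l ;
  rkhs_inj : injective ev ;
  rkhs_kernel : forall z, exists kz : H,
    (forall l, ev kz l = k l z) /\ (forall f, ev f z = hdot f kz)
}.

(* [T] is the Hilbert space tensor product of [H1] and [H2] *)
Record is_htensor (H1 H2 : hilbertType R) T (tens : H1 -> H2 -> T) : Prop := {
  htensor_linearl : forall (a : R[i]) f g y,
    tens (a *: f + g) y = a *: tens f y + tens g y ;
  htensor_linearr : forall (a : R[i]) f y y',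
    tens f (a *: y + y') = a *: tens f y + tens f y' ;
  htensor_hdot : forall f g y y',
    hdot (tens f y) (tens g y') = hdot f g * hdot y y' ;
  htensor_total : cspan [set t | exists f y, t = tens f y] = setT
}.

(* [T] is the tensor product of [Y] with the scalar function space [(H, ev)],
   its elements being read as [Y]-valued functions through [evT]. *)
Record is_vector_space_of H (ev : H -> B -> R[i]) Y T (evT : T -> B -> Y) : Prop := {
  vfs_tensor : exists tens : H -> Y -> T, is_htensor tens /\
    (forall f y l, evT (tens f y) l = ev f l *: y) ;
  vfs_linear : forall (a : R[i]) s t l,
    evT (a *: s + t) l = a *: evT s l + evT t l ;
  vfs_continuous : forall l, continuous (evT ^~ l)
}.

(* Complex (Frechet) differentiability for the operator norm. *)
Definition analytic U Y (S : B -> 'L(U, Y)) : Prop :=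
  forall l, exists D : 'I_d -> 'L(U, Y), forall e : R[i], 0 < e ->
  exists2 r : R[i], 0 < r & forall m : B,
    \sum_j `|m 0 j - l 0 j| < r -> forall u : U,
    `|S m u - S l u - \sum_j (m 0 j - l 0 j) *: D j u|
      <= e * (\sum_j `|m 0 j - l 0 j|) * `|u|.

Definition contractive_multiplier U Y (S : B -> 'L(U, Y)) : Prop :=
  exists (H HU HY : hilbertType R) (ev : H -> B -> R[i])
    (evU : HU -> B -> U) (evY : HY -> B -> Y),
  [/\ is_rkhs kd ev, is_vector_space_of ev evU, is_vector_space_of ev evY
    & forall f : HU, exists2 g : HY,
        (forall l, evY g l = S l (evU f l)) & `|g| <= `|f|].

Definition schur_class U Y (S : B -> 'L(U, Y)) : Prop :=
  analytic S /\ contractive_multiplier S.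

Definition kernel_S U Y (S : B -> 'L(U, Y)) l z : Y -> Y :=
  fun y => kd l z *: (y - S l (adj (S z) y)).

End multipliers.

Section output_pair.
Context (R : realType) (d : nat) (X Y : hilbertType R).
Context (C : 'L(X, Y)) (A : 'I_d -> 'L(X, X)).
Local Notation B := (unit_ball R d).
Implicit Types (l z : B).

Definition contractive_pair : Prop :=
  op_le (fun x => \sum_j adj (A j) (A j x) + adj C (C x)) (fun x : X => x).

Definition kernel_CA l z : Y -> Y := fun y =>
  C (op_inv (fun x => x - \sum_j l 0 j *: A j x)
    (op_inv (fun x => x - \sum_j (z 0 j)^* *: adj (A j) x) (adj C y))).

Definition colA : X -> hpow X d := fun x => [ffun j => A j x].

Definition rowZ l : hpow X d -> X := fun p => \sum_j l 0 j *: p j.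

Definition spaceD : set (hpow X d) := [set p | exists z y,
  p = adj (rowZ z) (op_inv (fun x => x - adj colA (adj (rowZ z) x)) (adj C y))].

Definition opT : hsum (hspan spaceD) Y -> X := fun p =>
  adj colA (hspan_val p.1) + adj C p.2.

(* (I - T^* T)^(1/2) *)
Definition defectT : hsum (hspan spaceD) Y -> hsum (hspan spaceD) Y :=
  op_sqrt (fun p => p - adj opT (opT p)).

(* The closure of the range of [defectT]; this range being a subspace, its
   closed linear span is its closure. *)
Definition ran_defect : hilbertType R := hspan (range defectT).

Definition solution (U : hilbertType R) (S : B -> 'L(U, Y)) : Prop :=
  schur_class S /\ forall l z y, kernel_S S l z y = kernel_CA l z y.

(* The value at [l] of the function with parameter [G] *)
Definition param_fun (U : hilbertType R) (G : 'L(ran_defect, U)) l : U -> Y :=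
  fun u => let p := defectT (hspan_val (adj G u)) in
  C (op_inv (fun x => x - rowZ l (colA x)) (rowZ l (hspan_val p.1))) + p.2.

(* [P] holds exactly for the functions [S0 W] with [W] a constant unitary. *)
Definition unique_up_to_right_unitary (U : hilbertType R)
    (P : (B -> 'L(U, Y)) -> Prop) : Prop :=
  exists2 S0, P S0 & forall S, P S <->
    exists2 W : 'L(U, U), unitary W & forall l u, S l u = S0 l (W u).

End output_pair.

(* Main.v *)
(** For y in Y and z in the ball put v = (I - A^* Z(z)^* )^-1 C^* y and
    w = (Z(z)^* v, y). Then T w = v, and since <w, w'> = <l, z> <v, v'> + <y, y'>,
    the vectors e = (I - T^* T)^(1/2) w have the Gram matrix
    <y, y'> - (1 - <l, z>) <v, v'>, whereas <v, v'> = <K_{C,A}(l, z) y, y'>.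
    Hence K_S = K_{C,A} says exactly that the vectors S(z)^* y have the same Gram
    matrix as the vectors e, that is, since the latter are total in the closure of
    Ran (I - T^* T)^(1/2), that S(z)^* y = G e for an isometry G; taking adjoints gives
    the formula for S. The isometries G exist if and only if the dimension
    inequality holds, and two unitary ones differ by a unitary operator of U.
    That such an S is a contractive multiplier follows from the positivity of
    K_{C,A}; the spaces H_Y(k_d) are realized inside the full Fock space. *)

Require Import Defs.
From HB Require Import structures.
From mathcomp Require Import all_boot all_order all_algebra complex.
From mathcomp Require Import all_classical all_reals interval_inference.
From mathcomp Require Import topology normedtype sequences.
From mathcomp Require Import ring lra.
Set Implicit Arguments.
Unset Strict Implicit.
Unset Printing Implicit Defensive.
Import Order.TTheory GRing.Theory Num.Theory.
Import numFieldNormedType.Exports.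
Local Open Scope classical_set_scope.
Local Open Scope complex_scope.
Local Open Scope ring_scope.

(** * Inner products and real-valued norms *)

(** [adj], [op_inv] and [op_sqrt] are defined by choice and say nothing until existence is known;
    Riesz representation, inversion of I - M for a strict contraction M, and an iteration for the
    square root supply it. Most operators without a formula come from one device,
    [blinear_extension]: a family with total range, a second family, and a norm inequality between
    their finite combinations. The isometry G, the inverse of I - M, the tensor maps and the adjoint
    of a multiplication operator arise in this way. The multiplier property is existential in the
    model of H(k_d), so one model suffices. Over the words of the Fock space the kernel is a
    geometric series, which replaces the abstract completion of a positive kernel. Differentiability
    in operator norm is derived from resolvent identities. In infinite dimension an isometry between
    spaces of equal dimension may fail to be onto, as the unilateral shift shows; uniqueness up to a
    unitary factor is therefore proved in finite dimension, and in general among the unitary G. *)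

Section inner_product.
Context (R : realType).
Implicit Types (H : hilbertType R) (a : R[i]).

(** The norm of a Hilbert space takes values in [R[i]]; its real part carries the same information
    and lives where infima and linear arithmetic are available. *)
Definition hnorm H (x : H) : R := complex.Re `|x|.

Lemma hnormE H (x : H) : `|x| = (hnorm x)%:C.
Proof. by rewrite [RHS]RRe_real// normr_real. Qed.

Lemma realC_inj : injective (fun r : R => r%:C).
Proof. by move=> x y []. Qed.

Lemma realCD (x y : R) : (x + y)%:C = x%:C + y%:C. Proof. exact: rmorphD. Qed.
Lemma realCM (x y : R) : (x * y)%:C = x%:C * y%:C. Proof. exact: rmorphM. Qed.

Lemma hnorm_ge0 H (x : H) : 0 <= hnorm x.
Proof. by rewrite -lecR -hnormE normr_ge0. Qed.

Lemma hnorm_sq H (x : H) : hdot x x = ((hnorm x) ^+ 2)%:C.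
Proof. by rewrite hdot_norm hnormE rmorphXn. Qed.

Lemma hnorm_eq0 H (x : H) : hnorm x = 0 -> x = 0.
Proof. by move=> x0; apply/eqP; rewrite -normr_eq0 hnormE x0. Qed.

Lemma hnorm0 H : hnorm (0 : H) = 0.
Proof. by rewrite /hnorm normr0. Qed.

Lemma hnormN H (x : H) : hnorm (- x) = hnorm x.
Proof. by rewrite /hnorm normrN. Qed.

Lemma hnormB H (x y : H) : hnorm (x - y) = hnorm (y - x).
Proof. by rewrite -opprB hnormN. Qed.

Lemma hnormD H (x y : H) : hnorm (x + y) <= hnorm x + hnorm y.
Proof. by rewrite -lecR rmorphD /= -!hnormE ler_normD. Qed.

Lemma hnorm_dist H (y x z : H) : hnorm (x - z) <= hnorm (x - y) + hnorm (y - z).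
Proof. by rewrite -[x - z](subrKA y) hnormD. Qed.

Lemma hnorm_le_sq H (K : hilbertType R) (x : H) (y : K) :
  hnorm x ^+ 2 <= hnorm y ^+ 2 -> hnorm x <= hnorm y.
Proof. by rewrite ler_pXn2r ?nnegrE ?hnorm_ge0. Qed.

Lemma hnorm_eq_sq H (K : hilbertType R) (x : H) (y : K) :
  hnorm x ^+ 2 = hnorm y ^+ 2 -> hnorm x = hnorm y.
Proof. by move=> xy; apply/le_anti; rewrite !hnorm_le_sq ?xy. Qed.

Definition cnorm (a : R[i]) : R := complex.Re `|a|.

Lemma cnormE a : `|a| = (cnorm a)%:C.
Proof. by rewrite [RHS]RRe_real// normr_real. Qed.

Lemma cnorm_ge0 a : 0 <= cnorm a.
Proof. by rewrite -lecR -cnormE normr_ge0. Qed.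

Lemma cnorm_eq0 a : cnorm a = 0 -> a = 0.
Proof. by move=> x0; apply/eqP; rewrite -normr_eq0 cnormE x0. Qed.

Lemma cnormM a b : cnorm (a * b) = cnorm a * cnorm b.
Proof. by apply: realC_inj; rewrite rmorphM /= -!cnormE normrM. Qed.

Lemma cnormD a b : cnorm (a + b) <= cnorm a + cnorm b.
Proof. by rewrite -lecR rmorphD /= -!cnormE ler_normD. Qed.

Lemma cnorm_sq a : a * a^* = ((cnorm a) ^+ 2)%:C.
Proof. by rewrite rmorphXn /= -cnormE normCK. Qed.

Lemma cnormC a : cnorm a^* = cnorm a.
Proof. by rewrite /cnorm norm_conjC. Qed.

Lemma cnorm_real (r : R) : 0 <= r -> cnorm r%:C = r.
Proof. by move=> r0; rewrite /cnorm ger0_norm// lecR. Qed.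

Lemma hnormZ H a (x : H) : hnorm (a *: x) = cnorm a * hnorm x.
Proof. by apply: realC_inj; rewrite rmorphM /= -!hnormE normrZ cnormE. Qed.

Lemma hdotDl H (x y z : H) : hdot (x + y) z = hdot x z + hdot y z.
Proof. by have := hdot_linearl 1 x y z; rewrite scale1r mul1r. Qed.

Lemma hdot0l H (z : H) : hdot 0 z = 0.
Proof. by apply/(addIr (hdot 0 z)); rewrite -hdotDl !add0r. Qed.

Lemma hdotZl H a (x z : H) : hdot (a *: x) z = a * hdot x z.
Proof. by have := hdot_linearl a x 0 z; rewrite !addr0 hdot0l addr0. Qed.

Lemma hdotNl H (x z : H) : hdot (- x) z = - hdot x z.
Proof. by rewrite -scaleN1r hdotZl mulN1r. Qed.

Lemma hdotBl H (x y z : H) : hdot (x - y) z = hdot x z - hdot y z.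
Proof. by rewrite hdotDl hdotNl. Qed.

Lemma hdotDr H (x y z : H) : hdot x (y + z) = hdot x y + hdot x z.
Proof. by rewrite hdotC hdotDl rmorphD /= -!hdotC. Qed.

Lemma hdot0r H (x : H) : hdot x 0 = 0.
Proof. by rewrite hdotC hdot0l rmorph0. Qed.

Lemma hdotZr H a (x y : H) : hdot x (a *: y) = a^* * hdot x y.
Proof. by rewrite hdotC hdotZl rmorphM /= -hdotC. Qed.

Lemma hdotNr H (x z : H) : hdot x (- z) = - hdot x z.
Proof. by rewrite hdotC hdotNl rmorphN /= -hdotC. Qed.

Lemma hdotBr H (x y z : H) : hdot x (y - z) = hdot x y - hdot x z.
Proof. by rewrite hdotDr hdotNr. Qed.

Lemma hdot_suml H I (r : seq I) (P : pred I) (F : I -> H) z :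
  hdot (\sum_(i <- r | P i) F i) z = \sum_(i <- r | P i) hdot (F i) z.
Proof.
apply: (big_morph (fun x => hdot x z)) => [x y|]; first exact: hdotDl.
exact: hdot0l.
Qed.

Lemma hdot_sumr H I (r : seq I) (P : pred I) (F : I -> H) z :
  hdot z (\sum_(i <- r | P i) F i) = \sum_(i <- r | P i) hdot z (F i).
Proof.
apply: (big_morph (hdot z)) => [x y|]; first exact: hdotDr.
exact: hdot0r.
Qed.

Lemma hnorm_cauchy_schwarz H (x y : H) : cnorm (hdot x y) <= hnorm x * hnorm y.
Proof.
rewrite -lecR rmorphM /= -!hnormE -cnormE.
have := @dot_cauchy_schwarz _ H (@hdot R H) (@hdot_linearl R H) (@hdotC R H).
move=> /(_ _ _ x y).
have nE (z : H) : dot_norm (@hdot R H) z = `|z|.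
  by rewrite /dot_norm hdot_norm sqrCK.
rewrite !nE; apply=> z; rewrite hdot_norm ?exprn_ge0//.
by move=> /eqP; rewrite expf_eq0 /= normr_eq0 => /eqP.
Qed.

Lemma hnorm_le_dual H (x : H) (a : R) : 0 <= a ->
  (forall y, cnorm (hdot x y) <= a * hnorm y) -> hnorm x <= a.
Proof.
move=> a0 /(_ x); rewrite hnorm_sq cnorm_real ?exprn_ge0 ?hnorm_ge0// expr2.
have [->//|x0] := eqVneq (hnorm x) 0.
by rewrite ler_pM2r// lt_def x0 hnorm_ge0.
Qed.

Lemma hdot_ext H (x y : H) : (forall z, hdot z x = hdot z y) -> x = y.
Proof.
move=> xy; apply/subr0_eq/hnorm_eq0/eqP; rewrite -sqrf_eq0; apply/eqP/realC_inj.
by rewrite -hnorm_sq hdotBr xy subrr.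
Qed.

Lemma hdot_extl H (x y : H) : (forall z, hdot x z = hdot y z) -> x = y.
Proof. by move=> xy; apply: hdot_ext => z; rewrite hdotC xy -hdotC. Qed.

Lemma hnormD_sq H (x y : H) :
  ((hnorm (x + y)) ^+ 2)%:C = ((hnorm x) ^+ 2)%:C + ((hnorm y) ^+ 2)%:C
    + (hdot x y + (hdot x y)^*).
Proof. by rewrite -!hnorm_sq hdotDl !hdotDr (hdotC y x); ring. Qed.

Lemma pythagoras H (x y : H) : hdot x y = 0 ->
  hnorm (x + y) ^+ 2 = hnorm x ^+ 2 + hnorm y ^+ 2.
Proof.
move=> xy; apply: realC_inj; rewrite hnormD_sq xy rmorph0 !addr0.
by rewrite realCD.
Qed.

Lemma parallelogram H (x y : H) :
  hnorm (x + y) ^+ 2 + hnorm (x - y) ^+ 2 = 2 * (hnorm x ^+ 2 + hnorm y ^+ 2).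
Proof.
apply: realC_inj; rewrite mulr_natl mulr2n !realCD !hnormD_sq hnormN hdotNr.
by rewrite rmorphN /=; ring.
Qed.

Lemma hsum_hnorm (V W : hilbertType R) (p : hsum V W) :
  hnorm p ^+ 2 = hnorm p.1 ^+ 2 + hnorm p.2 ^+ 2.
Proof. by apply: realC_inj; rewrite rmorphD /= -!hnorm_sq. Qed.

Lemma hpow_hdot (V : hilbertType R) d (p q : hpow V d) :
  hdot p q = \sum_j hdot (p j) (q j).
Proof. by []. Qed.

Lemma hsum_hdot (V W : hilbertType R) (p q : hsum V W) :
  hdot p q = hdot p.1 q.1 + hdot p.2 q.2.
Proof. by []. Qed.

Lemma hpow_hnorm (V : hilbertType R) d (p : hpow V d) :
  hnorm p ^+ 2 = \sum_j hnorm (p j) ^+ 2.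
Proof.
apply: realC_inj; rewrite -hnorm_sq hpow_hdot rmorph_sum /=.
by apply: eq_bigr => j _; rewrite hnorm_sq.
Qed.

Lemma hspan_hdot H (A : set H) (x y : hspan A) :
  hdot x y = hdot (hspan_val x) (hspan_val y).
Proof. by []. Qed.

Lemma hspan_hnorm H (A : set H) (x : hspan A) : hnorm x = hnorm (x : H).
Proof. by apply: realC_inj; rewrite -!hnormE hspan_normE. Qed.

End inner_product.

(** * Orthogonal projections and total sets *)

Section hilbert_geometry.
Context (R : realType).
Implicit Types (H U V W : hilbertType R) (a : R[i]).

Definition hlim H (u : nat -> H) (l : H) : Prop := forall e : R, 0 < e ->
  exists N, forall n, (N <= n)%N -> hnorm (u n - l) < e.

Lemma eq0_of_le_eps (r : R) : 0 <= r -> (forall e, 0 < e -> r <= e) -> r = 0.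
Proof.
move=> r0 re; apply/le_anti; rewrite r0 andbT; apply/ler_addgt0Pr => e /re.
by rewrite add0r.
Qed.

Lemma invn_lt (e : R) : 0 < e ->
  exists N, forall n, (N <= n)%N -> n.+1%:R^-1 < e.
Proof.
move=> e0; have [N _ HN] := near_infty_natSinv_lt (PosNum e0).
by exists N => n /HN.
Qed.

Lemma pos_realC (e : R[i]) : 0 < e -> exists2 r : R, 0 < r & e = r%:C.
Proof.
move=> e0; have er : e = (complex.Re e)%:C by rewrite RRe_real// gtr0_real.
by exists (complex.Re e) => //; rewrite -ltcR -er.
Qed.

Lemma hcomplete H (u : nat -> H) :
  (forall e : R, 0 < e -> exists N, forall n m, (N <= n)%N -> (N <= m)%N ->
    hnorm (u n - u m) < e) -> exists l, hlim u l.
Proof.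
move=> uC; have ucvg : cvg (u @ \oo).
  apply: cauchy_cvg; apply: cauchy_exP => e /pos_realC[r r0 ->].
  have [N HN] := uC r r0; exists (u N); exists N => // n /= Nn.
  by rewrite -ball_normE /= hnormE ltcR; apply: HN.
exists (lim (u @ \oo)) => e e0.
have /cvgrPdist_lt/(_ e%:C) := ucvg; rewrite ltcR => /(_ e0)[N _ HN].
by exists N => n /HN /=; rewrite hnormE ltcR hnormB.
Qed.

Lemma hlim_uniq H (u : nat -> H) l l' : hlim u l -> hlim u l' -> l = l'.
Proof.
move=> ul ul'; apply/subr0_eq/hnorm_eq0/eq0_of_le_eps => [|e e0]; first exact: hnorm_ge0.
have e20 : 0 < e / 2 by rewrite divr_gt0.
have [N HN] := ul _ e20; have [N' HN'] := ul' _ e20.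
have := HN (maxn N N') (leq_maxl _ _); have := HN' (maxn N N') (leq_maxr _ _).
rewrite (hnormB _ l) => h1 h2; apply/ltW.
have := hnorm_dist (u (maxn N N')) l l'; lra.
Qed.

Definition closed_subspace H (M : set H) : Prop := [/\ M 0,
  forall a x y, M x -> M y -> M (a *: x + y) &
  forall x, (forall e : R, 0 < e -> exists2 y, M y & hnorm (x - y) < e) -> M x].

Lemma closed_subspace_scale H (M : set H) a x : closed_subspace M -> M x ->
  M (a *: x).
Proof. by move=> [M0 MZ _] Mx; rewrite -[_ *: _]addr0; apply: MZ. Qed.

Lemma closed_subspace_add H (M : set H) x y : closed_subspace M -> M x ->
  M y -> M (x + y).
Proof. by move=> [M0 MZ _] Mx My; rewrite -[x]scale1r; apply: MZ. Qed.

Lemma cspan_approx H (A : set H) (x : H) :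
  cspan A x <-> forall e : R, 0 < e -> exists2 y, lspan A y & hnorm (x - y) < e.
Proof.
split=> [/cspanP Ax e e0|Ax].
  by have [|y Ay] := Ax e%:C; rewrite ?ltcR// hnormE ltcR; exists y.
apply/cspanP => _ /pos_realC[e e0 ->]; have [y Ay xy] := Ax e e0.
by exists y => //; rewrite hnormE ltcR.
Qed.

Lemma lspan_cspan H (A : set H) : lspan A `<=` cspan A.
Proof. by move=> x Ax; apply/cspan_approx => e e0; exists x; rewrite ?subrr ?hnorm0. Qed.

Lemma lspan_gen H (A : set H) : A `<=` lspan A.
Proof.
move=> x Ax; exists 1%N, (fun=> 1), (fun=> x).
by split=> //; rewrite big_ord1 scale1r.
Qed.

Lemma cspan_gen H (A : set H) : A `<=` cspan A.
Proof. by move=> x /lspan_gen/lspan_cspan. Qed.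

Lemma cspan_closed H (A : set H) : closed_subspace (cspan A).
Proof.
split=> [|a x y|x xA]; [exact: cspan0|exact: cspanDZ|].
apply/cspan_approx => e e0; have e20 : 0 < e / 2 by rewrite divr_gt0.
have [y /cspan_approx/(_ _ e20)[z Az yz] xy] := xA _ e20.
exists z => //; have := hnorm_dist y x z; lra.
Qed.

Lemma cspan_min H (A M : set H) : closed_subspace M -> A `<=` M -> cspan A `<=` M.
Proof.
move=> Mc AM x /cspan_approx xA; have [M0 MZ MC] := Mc; apply: MC => e /xA[y Ay xy].
exists y => //; have [n [c [s [As ->]]]] := Ay.
elim/big_rec : _ => // i z _ Mz; apply: MZ => //; exact: AM.
Qed.

(** A minimizing sequence for the distance from x to M is Cauchy by the parallelogram law, and the
    residual of the minimizer is orthogonal to M, since otherwise a component along some z in M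
    could be removed to shorten it. *)
Lemma projection H (M : set H) (x : H) : closed_subspace M ->
  exists2 y, M y & forall z, M z -> hdot (x - y) z = 0.
Proof.
move=> Mc; have [M0 MZ MC] := Mc.
pose D := [set r : R | exists2 y, M y & r = hnorm (x - y)].
have Dlb : lbound D 0 by move=> _ [y _ ->]; exact: hnorm_ge0.
have Dinf : has_inf D by split; [exists (hnorm (x - 0)), 0|exists 0].
set r := inf D.
have r0 : 0 <= r by apply: lb_le_inf => //; case: Dinf.
have rle y : M y -> r <= hnorm (x - y).
  by move=> My; apply: inf_lbound; [case: Dinf|exists y].
have appr n : exists y, M y /\ hnorm (x - y) < r + n.+1%:R^-1.
  have [||_ [y My ->] yr] := @inf_adherent _ D n.+1%:R^-1 => //.
  by exists y.
have /choice[y yP] := appr.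
have yC n m : hnorm (y n - y m) ^+ 2 <=
    2 * ((r + n.+1%:R^-1) ^+ 2 + (r + m.+1%:R^-1) ^+ 2) - 4 * r ^+ 2.
  have := parallelogram (x - y n) (x - y m).
  have -> : x - y n - (x - y m) = y m - y n.
    by rewrite opprB addrC subrKA.
  have -> : x - y n + (x - y m) = 2 *: (x - 2^-1 *: (y n + y m)).
    by rewrite scalerBr scalerA divff// scale1r scaler_nat mulr2n opprD addrACA.
  rewrite hnormZ (hnormB (y m)).
  have -> : cnorm (2 : R[i]) = 2.
    by rewrite -[2 in LHS](rmorph_nat (real_complex R)) cnorm_real.
  (* The midpoint of [y n] and [y m] lies in M, so its distance to x is at least r. *)
  have h : r <= hnorm (x - 2^-1 *: (y n + y m)).
    apply: rle; apply: closed_subspace_scale => //.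
    by apply: closed_subspace_add => //; case: (yP n); case: (yP m).
  have hn : hnorm (x - y n) ^+ 2 <= (r + n.+1%:R^-1) ^+ 2.
    by rewrite lerXn2r ?nnegrE ?hnorm_ge0 ?addr_ge0//; case: (yP n) => _ /ltW.
  have hm : hnorm (x - y m) ^+ 2 <= (r + m.+1%:R^-1) ^+ 2.
    by rewrite lerXn2r ?nnegrE ?hnorm_ge0 ?addr_ge0//; case: (yP m) => _ /ltW.
  have h2 : r ^+ 2 <= hnorm (x - 2^-1 *: (y n + y m)) ^+ 2.
    by rewrite lerXn2r ?nnegrE ?hnorm_ge0.
  rewrite exprMn; move: hn hm h2.
  move: (_ ^+ 2) (_ ^+ 2) (_ ^+ 2) (_ ^+ 2) (_ ^+ 2) (_ ^+ 2) => *; lra.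
have [l yl] : exists l, hlim y l.
  apply: hcomplete => e e0.
  (* For p, q < c <= 1 the bound in [yC] equals 4 r (p + q) + 2 (p^2 + q^2), and p^2 <= p, q^2 <= q
     put it below c (8 r + 8) <= e^2. *)
  pose c := Num.min 1 (e ^+ 2 / (8 * r + 8)).
  have d0 : 0 < 8 * r + 8 by lra.
  have c0 : 0 < c by rewrite lt_min ltr01 divr_gt0// exprn_gt0.
  have c1 : c <= 1 by rewrite ge_min lexx.
  have ce : c * (8 * r + 8) <= e ^+ 2.
    by rewrite -ler_pdivlMr// ge_min lexx orbT.
  have [N HN] := invn_lt c0; exists N => n m Nn Nm.
  rewrite -(@ltr_pXn2r _ 2)// ?nnegrE ?hnorm_ge0 ?(ltW e0)//.
  apply: le_lt_trans (yC n m) _; apply: lt_le_trans ce.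
  have := HN _ Nn; have := HN _ Nm.
  have : 0 <= n.+1%:R^-1 :> R by []. have : 0 <= m.+1%:R^-1 :> R by [].
  move: n.+1%:R^-1 m.+1%:R^-1 => p q q0 p0 qc pc.
  have p2 : p * p <= p by rewrite ler_piMr//; lra.
  have q2 : q * q <= q by rewrite ler_piMr//; lra.
  have pr : r * p <= r * c by rewrite ler_wpM2l// ltW.
  have qr : r * q <= r * c by rewrite ler_wpM2l// ltW.
  by rewrite !expr2; lra.
have Ml : M l.
  apply: MC => e /yl[N /(_ N (leqnn _)) HN]; exists (y N); first by case: (yP N).
  by rewrite hnormB.
have lr : hnorm (x - l) <= r.
  apply/ler_addgt0Pr => e e0; have e20 : 0 < e / 2 by rewrite divr_gt0.
  have [N HN] := yl _ e20; have [N' HN'] := invn_lt e20.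
  have := HN (maxn N N') (leq_maxl _ _); have := HN' (maxn N N') (leq_maxr _ _).
  have [_] := yP (maxn N N').
  have := hnorm_dist (y (maxn N N')) x l.
  by move: _.+1%:R^-1 => p; lra.
exists l => // z Mz; set w := x - l.
have [->|z0] := eqVneq z 0; first exact: hdot0r.
have zz : hdot z z != 0.
  apply: contra_neq z0; rewrite hnorm_sq => /realC_inj/eqP.
  by rewrite sqrf_eq0 => /eqP/hnorm_eq0.
(* [t *: z] is the component of w along z. Removing it leaves x minus a point of M, hence a vector
   of norm at least r, so by Pythagoras the component is zero. *)
pose t := hdot w z / hdot z z.
have orth : hdot (w - t *: z) (t *: z) = 0.
  by rewrite hdotZr hdotBl hdotZl /t divfK// subrr mulr0.
have := pythagoras orth; rewrite subrK => pyth.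
have : hnorm w ^+ 2 <= hnorm (w - t *: z) ^+ 2.
  rewrite lerXn2r ?nnegrE ?hnorm_ge0//; apply: le_trans lr _.
  rewrite /w -addrA -opprD; apply: rle; apply: closed_subspace_add => //.
  exact: closed_subspace_scale.
rewrite pyth gerDl => tz.
have /eqP : hnorm (t *: z) ^+ 2 = 0 by apply/le_anti; rewrite tz exprn_ge0// hnorm_ge0.
rewrite sqrf_eq0 => /eqP/hnorm_eq0/eqP; rewrite scaler_eq0 (negPf z0) orbF.
by rewrite mulf_eq0 invr_eq0 (negPf zz) orbF => /eqP.
Qed.

Lemma total_of_orth H (A : set H) :
  (forall z, (forall x, A x -> hdot x z = 0) -> z = 0) -> cspan A = setT.
Proof.
move=> Atot; apply/seteqP; split=> // x _.
have [y Ay xy] := projection x (cspan_closed A).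
suff : x - y = 0 by move=> /subr0_eq ->.
apply: Atot => z /cspan_gen Az; rewrite hdotC xy// rmorph0 //.
Qed.

Lemma orth_cspan H (A : set H) y z :
  (forall x, A x -> hdot x z = 0) -> cspan A y -> hdot y z = 0.
Proof.
move=> Az; have zC : closed_subspace [set x | hdot x z = 0].
  split=> [|a x x' /= xz xz'|x /= xC]; first exact: hdot0l.
    by rewrite hdot_linearl xz xz' mulr0 addr0.
  apply/cnorm_eq0/eq0_of_le_eps => [|e e0]; first exact: cnorm_ge0.
  have z1 : 0 < hnorm z + 1 by rewrite ltr_wpDl// hnorm_ge0.
  have [|x' x'z xx'] := xC (e / (hnorm z + 1)); first by rewrite divr_gt0.
  have -> : hdot x z = hdot (x - x') z by rewrite hdotBl x'z subr0.
  apply: le_trans (hnorm_cauchy_schwarz _ _) _.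
  move: xx'; rewrite ltr_pdivlMr// => /ltW; apply: le_trans.
  by rewrite ler_wpM2l ?hnorm_ge0// lerDl.
exact: (cspan_min zC Az).
Qed.

Lemma hdot_eq0 H (x : H) : hdot x x = 0 -> x = 0.
Proof.
rewrite hnorm_sq => /realC_inj/eqP.
by rewrite sqrf_eq0 => /eqP/hnorm_eq0.
Qed.

Lemma orth_of_total H (A : set H) z : cspan A = setT ->
  (forall x, A x -> hdot x z = 0) -> z = 0.
Proof.
by move=> AT Az; apply/hdot_eq0/(orth_cspan Az); rewrite AT.
Qed.

(** Shrinks the ambient space to the one generated by the family, which makes the family total
    without changing its Gram matrix. *)
Lemma cspan_hspan_gen (I : Type) H (k : I -> H) :
  exists k' : I -> hspan (range k),
    (forall i j, hdot (k' i) (k' j) = hdot (k i) (k j)) /\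
    cspan (range k') = setT.
Proof.
have kP i : k i \in in_cspan (range k) by apply/mem_set/cspan_gen; exists i.
exists (fun i => HSpan (kP i)); split=> //; apply: total_of_orth => z zP.
apply/val_inj/hdot_eq0/(@orth_cspan _ (range k)).
  by move=> _ [i _ <-]; apply: (zP (HSpan (kP i))); exists i.
by apply/set_mem; case: z {zP}.
Qed.
End hilbert_geometry.

(** * Bounded linear maps and adjoints *)

Section bounded_linear.
Context (R : realType).
Implicit Types (H U V W : hilbertType R) (a : R[i]).

(** A predicate on bare functions, because [adj], [op_inv] and [op_sqrt] return bare functions;
    [blinear_op] bundles the result when an operator is asked for. *)
Definition blinear U V (f : U -> V) : Prop :=
  (forall a x y, f (a *: x + y) = a *: f x + f y) /\
  exists2 M : R, 0 <= M & forall x, hnorm (f x) <= M * hnorm x.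

Lemma op_blinear U V (F : 'L(U, V)) : blinear F.
Proof.
split; first by move=> a x y; rewrite linearP.
have /linear_boundedP[M [Mr MF]] :=
  continuous_linear_bounded 0 (@op_continuous R U V F 0).
have ME : M = (complex.Re M)%:C by rewrite RRe_real.
exists (`|complex.Re M| + 1) => [|x]; first by rewrite addr_ge0.
rewrite -lecR realCM -!hnormE; apply: MF.
by rewrite ME ltcR (le_lt_trans (ler_norm _))// ltrDl.
Qed.

Lemma blinear_op U V (f : U -> V) : blinear f ->
  exists F : 'L(U, V), forall x, F x = f x.
Proof.
move=> [fL [M M0 Mf]].
have fL' : linear f by move=> a x y; exact: fL.
pose g : {linear U -> V} := HB.pack f (GRing.isLinear.Build _ _ _ _ f fL').
suff gc : continuous g by exists (BoundedOp gc).
apply/linear_bounded_continuous/linear_boundedP.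
exists M%:C; split=> [|r Mr x]; first by rewrite ger0_real ?lecR.
have -> : r = (complex.Re r)%:C.
  by rewrite RRe_real// gtr0_real// (le_lt_trans _ Mr)// lecR.
rewrite !hnormE -rmorphM lecR; apply: le_trans (Mf x) _.
apply: ler_wpM2r; first exact: hnorm_ge0.
by move: Mr; case: r => r1 r2; rewrite ltcE /= => /andP[_ /ltW].
Qed.

Section linear.
Context (U V : hilbertType R) (f : U -> V) (fL : blinear f).

Lemma blinearD x y : f (x + y) = f x + f y.
Proof. by have := fL.1 1 x y; rewrite !scale1r. Qed.

Lemma blinear0 : f 0 = 0.
Proof. by apply/(addIr (f 0)); rewrite -blinearD !add0r. Qed.

Lemma blinearZ a x : f (a *: x) = a *: f x.
Proof. by have := fL.1 a x 0; rewrite !addr0 blinear0 addr0. Qed.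

Lemma blinearN x : f (- x) = - f x.
Proof. by rewrite -scaleN1r blinearZ scaleN1r. Qed.

Lemma blinearB x y : f (x - y) = f x - f y.
Proof. by rewrite blinearD blinearN. Qed.

Lemma blinear_sum I (r : seq I) (P : pred I) (F : I -> U) :
  f (\sum_(i <- r | P i) F i) = \sum_(i <- r | P i) f (F i).
Proof. exact: (big_morph f blinearD blinear0). Qed.
End linear.

Lemma blinear_comp U V W (f : V -> W) (g : U -> V) :
  blinear f -> blinear g -> blinear (fun x => f (g x)).
Proof.
move=> fL gL; split=> [a x y|]; first by rewrite gL.1 fL.1.
have [_ [M M0 Mf]] := fL; have [_ [N N0 Ng]] := gL.
exists (M * N) => [|x]; first exact: mulr_ge0.
by rewrite (le_trans (Mf _))// -mulrA ler_wpM2l.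
Qed.

Lemma blinear_id U : blinear (fun x : U => x).
Proof. by split=> //; exists 1 => // x; rewrite mul1r. Qed.

Lemma blinear_cst0 U V : blinear (fun _ : U => 0 : V).
Proof.
split=> [a x y|]; first by rewrite scaler0 addr0.
by exists 0 => // x; rewrite hnorm0 mul0r.
Qed.

Lemma blinear_add U V (f g : U -> V) :
  blinear f -> blinear g -> blinear (fun x => f x + g x).
Proof.
move=> fL gL; split=> [a x y|].
  by rewrite gL.1 fL.1 scalerDr addrACA.
have [_ [M M0 Mf]] := fL; have [_ [N N0 Ng]] := gL.
exists (M + N) => [|x]; first exact: addr_ge0.
by rewrite (le_trans (hnormD _ _))// mulrDl lerD.
Qed.

Lemma blinear_scale U V a (f : U -> V) : blinear f -> blinear (fun x => a *: f x).
Proof.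
move=> fL; split=> [b x y|].
  by rewrite fL.1 scalerDr !scalerA mulrC.
have [_ [M M0 Mf]] := fL.
exists (cnorm a * M) => [|x]; first by rewrite mulr_ge0// cnorm_ge0.
by rewrite hnormZ -mulrA ler_wpM2l// cnorm_ge0.
Qed.

Lemma blinear_sub U V (f g : U -> V) :
  blinear f -> blinear g -> blinear (fun x => f x - g x).
Proof.
move=> fL gL; have := blinear_add fL (blinear_scale (-1) gL).
congr blinear; apply/funext => x; by rewrite scaleN1r.
Qed.

(** The kernel of phi is closed. If x lies outside it and w is the part of x orthogonal to it, then
    v - (phi v / phi x) w is in the kernel for every v, and pairing it with w computes phi v. *)
Lemma riesz H (phi : H -> R[i]) (M : R) :
  (forall a x y, phi (a *: x + y) = a * phi x + phi y) ->
  0 <= M -> (forall x, cnorm (phi x) <= M * hnorm x) ->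
  exists z, forall x, phi x = hdot x z.
Proof.
move=> phiL M0 Mphi.
have phi0 : phi 0 = 0.
  have := phiL 1 0 0; rewrite scale1r mul1r addr0 => /(congr1 (+%R^~ (- phi 0))).
  by rewrite addrK subrr.
have NC : closed_subspace [set x | phi x = 0].
  split=> [//|a x y /= x0 y0|x /= xC]; first by rewrite phiL x0 y0 mulr0 addr0.
  apply/cnorm_eq0/eq0_of_le_eps => [|e e0]; first exact: cnorm_ge0.
  have M1 : 0 < M + 1 by rewrite ltr_wpDl.
  have [|y y0 xy] := xC (e / (M + 1)); first by rewrite divr_gt0.
  have -> : phi x = phi (x - y).
    by rewrite -[x - y]addrC -scaleN1r phiL y0 mulr0 add0r.
  apply: le_trans (Mphi _) _; move: xy; rewrite ltr_pdivlMr// => /ltW.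
  by apply: le_trans; rewrite mulrC ler_wpM2l ?hnorm_ge0// lerDl.
have [all0|] := pselect (forall x, phi x = 0).
  by exists 0 => x; rewrite all0 hdot0r.
move=> /existsNP[x /eqP px].
have [y y0 xy] := projection x NC; set w := x - y.
have pw : phi w = phi x.
  by rewrite /w -[x - y]addrC -scaleN1r phiL y0 mulr0 add0r.
have ww : hdot w w != 0.
  apply: contraNneq px; rewrite hnorm_sq => /realC_inj/eqP.
  by rewrite sqrf_eq0 => /eqP/hnorm_eq0 w0; rewrite -pw w0 phi0.
exists (((phi x) / hdot w w)^* *: w) => v.
have : hdot w (v + (- (phi v / phi x)) *: w) = 0.
  by apply: xy => /=; rewrite addrC phiL pw mulNr divfK// addNr.
move=> /(congr1 (fun z => z^*)); rewrite rmorph0 -hdotC hdotDl hdotZl.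
move=> /eqP; rewrite addr_eq0 mulNr opprK => /eqP vw.
by rewrite hdotZr conjCK vw; field; rewrite ww px.
Qed.

Lemma adjP U V (f : U -> V) : blinear f ->
  forall x y, hdot (f x) y = hdot x (adj f y).
Proof.
move=> fL x y; have [_ [M M0 Mf]] := fL.
have [z zP] : exists z, forall x, hdot (f x) y = hdot x z.
  apply: (@riesz U (fun x => hdot (f x) y) (M * hnorm y)) => [a u v||u].
  - by rewrite fL.1 hdot_linearl.
  - by rewrite mulr_ge0// hnorm_ge0.
  - rewrite (le_trans (hnorm_cauchy_schwarz _ _))// mulrAC.
    by rewrite ler_wpM2r ?hnorm_ge0.
rewrite /adj; case: xgetP => [w _ /= ->//|/(_ z) /=]; exact: contra_notP.
Qed.

Lemma adj_uniq U V (f : U -> V) y z :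
  (forall x, hdot (f x) y = hdot x z) -> adj f y = z.
Proof.
move=> fz; rewrite /adj; case: xgetP => [w _ /= wP|/(_ z)/(_ fz)[]].
by apply: hdot_ext => x; rewrite -wP fz.
Qed.

Lemma adjP' U V (f : U -> V) : blinear f ->
  forall x y, hdot y (f x) = hdot (adj f y) x.
Proof. by move=> fL x y; rewrite hdotC adjP// -hdotC. Qed.

Lemma adj_bound U V (f : U -> V) M : blinear f -> 0 <= M ->
  (forall x, hnorm (f x) <= M * hnorm x) ->
  forall y, hnorm (adj f y) <= M * hnorm y.
Proof.
move=> fL M0 Mf y; apply: hnorm_le_dual => [|x].
  by rewrite mulr_ge0// hnorm_ge0.
rewrite -cnormC -hdotC -adjP//; apply: le_trans (hnorm_cauchy_schwarz _ _) _.
by rewrite mulrAC ler_wpM2r// hnorm_ge0.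
Qed.

Lemma adj_blinear U V (f : U -> V) : blinear f -> blinear (adj f).
Proof.
move=> fL; split=> [a x y|].
  apply: hdot_ext => z; rewrite -adjP// !hdotDr !hdotZr.
  by rewrite -!adjP.
have [_ [M M0 Mf]] := fL; exists M => //; exact: adj_bound.
Qed.

Lemma adjK U V (f : U -> V) : blinear f -> adj (adj f) = f.
Proof.
by move=> fL; apply/funext => x; apply: adj_uniq => y; rewrite adjP'.
Qed.

(** Continuity enters through the adjoints: [adj f z - adj g z] is orthogonal to the total set A,
    hence zero. *)
Lemma blinear_ext_total U V (A : set U) (f g : U -> V) :
  blinear f -> blinear g -> cspan A = setT -> (forall x, A x -> f x = g x) ->
  f = g.
Proof.
move=> fL gL AT fg; apply/funext => x; apply: hdot_ext => z.
have /subr0_eq zz : adj f z - adj g z = 0.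
  apply: (orth_of_total AT) => y Ay.
  by rewrite hdotBr -!adjP// fg// subrr.
by rewrite !adjP'// zz.
Qed.

Lemma blinear_extension (I : Type) U V (a : I -> U) (b : I -> V) (M : R) :
  0 <= M -> cspan (range a) = setT ->
  (forall n (c : 'I_n -> R[i]) (s : 'I_n -> I),
     hnorm (\sum_i c i *: b (s i)) <= M * hnorm (\sum_i c i *: a (s i))) ->
  exists f : U -> V, [/\ blinear f, forall i, f (a i) = b i &
    forall x, hnorm (f x) <= M * hnorm x].
Proof.
move=> M0 aT ab.
(* The extension is the function whose graph is the closed span of the pairs. *)
pose P := [set p : hsum U V | exists i, p = (a i, b i)].
have spanE n (c : 'I_n -> R[i]) (s : 'I_n -> I) :
    (\sum_i c i *: ((a (s i), b (s i)) : hsum U V)) =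
    (\sum_i c i *: a (s i), \sum_i c i *: b (s i)).
  elim: n c s => [|n IHn] c s; first by rewrite !big_ord0.
  by rewrite !big_ord_recl IHn.
have lP p : lspan P p -> hnorm p.2 <= M * hnorm p.1.
  move=> [n [c [q [/choice[s sP] ->]]]].
  under eq_bigr => i _ do rewrite sP.
  rewrite spanE; exact: ab.
have n1 (p : hsum U V) : hnorm p.1 <= hnorm p.
  by rewrite -lecR -!hnormE hsum_norm1.
have n2 (p : hsum U V) : hnorm p.2 <= hnorm p.
  by rewrite -lecR -!hnormE hsum_norm2.
(* The inequality survives the closure. It forces the second component to vanish with the first, so
   the closed span of the pairs is a graph. *)
have cP p : cspan P p -> hnorm p.2 <= M * hnorm p.1.
  move=> /cspan_approx Pp; apply/ler_addgt0Pr => e e0.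
  have M1 : 0 < M + 1 by rewrite ltr_wpDl.
  have [|q /lP qM pq] := Pp (e / (M + 1)); first by rewrite divr_gt0.
  move: pq; rewrite ltr_pdivlMr// => pq.
  have h2 : hnorm p.2 <= hnorm q.2 + hnorm (p - q).
    rewrite -lerBlDl; apply: le_trans (n2 (p - q)) => /=.
    by have := hnormD (p.2 - q.2) q.2; rewrite subrK; lra.
  have h1 : hnorm q.1 <= hnorm p.1 + hnorm (p - q).
    rewrite -lerBlDl; apply: le_trans (n1 (p - q)) => /=.
    by have := hnormD (q.1 - p.1) p.1; rewrite subrK (hnormB q.1); lra.
  have := ler_wpM2l M0 h1; rewrite mulrDr; lra.
have Pc := cspan_closed P; have [P0 PZ PC] := Pc.
(* The graph is defined everywhere: approximants of x from the span have second components that are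
   Cauchy by the same inequality. *)
have Pdef x : exists y, cspan P (x, y).
  have appr n : exists p : hsum U V, lspan P p /\ hnorm (x - p.1) < n.+1%:R^-1.
    have : cspan (range a) x by rewrite aT.
    move=> /cspan_approx/(_ n.+1%:R^-1)[//|_ [m [c [s' [s'a ->]]]] xy].
    have /choice[s sE] : forall i, exists j, a j = s' i.
      by move=> i; have [j _ <-] := s'a i; exists j.
    exists (\sum_i c i *: ((a (s i), b (s i)) : hsum U V)); split.
      by exists m, c, (fun i => (a (s i), b (s i))); split=> // i; exists (s i).
    by rewrite spanE /=; under eq_bigr => i _ do rewrite sE.
  have /choice[p pP] := appr.
  have [y py] : exists y, hlim (fun n => (p n).2) y.
    apply: hcomplete => e e0.
    have M1 : 0 < M + 1 by rewrite ltr_wpDl.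
    have e20 : 0 < e / 2 / (M + 1) by rewrite !divr_gt0.
    have [N HN] := invn_lt e20; exists N => n m Nn Nm.
    have := lP (p n - p m); rewrite -scaleN1r addrC => /(_ _)/=; move=> H1.
    have {}H1 := H1 (lspanDZ _ (pP m).1 (pP n).1).
    rewrite !scaleN1r !(addrC (- _)) in H1.
    apply: le_lt_trans H1 _.
    have h1 := hnorm_dist x (p n).1 (p m).1; rewrite (hnormB _ x) in h1.
    have hn := lt_trans (pP n).2 (HN _ Nn); have hm := lt_trans (pP m).2 (HN _ Nm).
    apply: (@le_lt_trans _ _ ((M + 1) * hnorm ((p n).1 - (p m).1))).
      by rewrite ler_wpM2r ?hnorm_ge0// lerDl.
    rewrite mulrC -ltr_pdivlMr//; apply: le_lt_trans h1 _.
    by rewrite [e]splitr mulrDl ltrD.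
  exists y; apply: PC => e e0; have e20 : 0 < e / 2 by rewrite divr_gt0.
  have [N HN] := py _ e20; have [N' HN'] := invn_lt e20.
  set n := maxn N N'; exists (p n); first exact/lspan_cspan/(pP n).1.
  have h1 := lt_trans (pP n).2 (HN' _ (leq_maxr N N')).
  have h2 := HN _ (leq_maxl N N').
  rewrite -ltcR -hnormE; apply: le_lt_trans (hsum_norm_le _) _ => /=.
  by rewrite !hnormE -realCD ltcR [e]splitr ltrD// hnormB.
have [f fP] := choice Pdef; exists f.
have fu x y : cspan P (x, y) -> f x = y.
  move=> xy; have := PZ (-1) _ _ (fP x) xy; rewrite !scaleN1r => /cP /=.
  rewrite addNr hnorm0 mulr0 => yx; apply/esym/subr0_eq; rewrite addrC.
  by apply/hnorm_eq0/le_anti; rewrite yx hnorm_ge0.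
have fM x : hnorm (f x) <= M * hnorm x by exact: cP (fP x).
split=> //.
  by split; [move=> k x y; apply: fu; exact (PZ k _ _ (fP x) (fP y))|exists M].
by move=> i; apply: fu; apply: cspan_gen; exists i.
Qed.

Lemma op_inv_eq V (f : V -> V) x y : injective f -> f x = y -> op_inv f y = x.
Proof.
move=> fI fx; rewrite /op_inv; case: xgetP => [z _ /= fz|/(_ x)/(_ fx)[]].
by apply: fI; rewrite fx fz.
Qed.

Lemma hnorm_isometric U V (G : U -> V) : isometric G ->
  forall x, hnorm (G x) = hnorm x.
Proof. by move=> GI x; rewrite /hnorm GI. Qed.

(** Polarization: comparing the norms of G (x + a y) and x + a y for a = 1 kills the real part of
    the difference of the inner products, and a = i kills the imaginary part. *)
Lemma isometric_hdot U V (G : U -> V) : blinear G -> isometric G ->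
  forall x y, hdot (G x) (G y) = hdot x y.
Proof.
move=> GL GI x y; pose D a := a^* * (hdot (G x) (G y) - hdot x y).
have DC a : D a + (D a)^* = 0.
  have := hnormD_sq (G x) (G (a *: y)).
  rewrite -(blinearD GL) !(hnorm_isometric GI) hnormD_sq => /addrI.
  rewrite (blinearZ GL) !hdotZr /D mulrBr rmorphB /= => /eqP; rewrite -subr_eq0.
  move=> /eqP E; rewrite -[RHS]oppr0 -[in RHS]E; ring.
have := DC 1; rewrite /D rmorph1 mul1r => /eqP; rewrite addr_eq0 => /eqP D1.
have /eqP := DC 'i; rewrite /D rmorphM /= conjCK conjCi mulNr addrC subr_eq0.
move=> /eqP/(mulfI (neq0Ci _)) D2.
apply/subr0_eq/eqP; move: D1; rewrite D2 => /eqP.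
by rewrite -addr_eq0 -mulr2n mulrn_eq0.
Qed.

Lemma isometric_adjK U V (G : U -> V) : blinear G -> isometric G ->
  forall x, adj G (G x) = x.
Proof. by move=> GL GI x; apply: adj_uniq => y; exact: isometric_hdot. Qed.

Lemma gram_extension (I : Type) U V (a : I -> U) (b : I -> V) :
  cspan (range a) = setT ->
  (forall i j, hdot (b i) (b j) = hdot (a i) (a j)) ->
  exists f : U -> V, [/\ blinear f, forall i, f (a i) = b i & isometric f].
Proof.
move=> aT ab.
have ab' n (c : 'I_n -> R[i]) (s : 'I_n -> I) :
    hnorm (\sum_i c i *: b (s i)) <= 1 * hnorm (\sum_i c i *: a (s i)).
  rewrite mul1r -(@ler_pXn2r _ 2)// ?nnegrE ?hnorm_ge0// -lecR -!hnorm_sq.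
  rewrite !hdot_suml le_eqVlt; apply/orP; left; apply/eqP; apply: eq_bigr => i _.
  rewrite !hdotZl !hdot_sumr; congr (_ * _); apply: eq_bigr => j _.
  by rewrite !hdotZr ab.
have [f [fL fab _]] := blinear_extension ler01 aT ab'.
exists f; split=> //.
(* The extension is so far only a contraction. Equality of the Gram matrices says that f^* f and the
   identity have the same matrix entries on the total family. *)
have ff : (fun x => adj f (f x)) = id.
  apply: (blinear_ext_total _ (@blinear_id U) aT).
    by apply: blinear_comp => //; exact: adj_blinear.
  move=> _ [i _ <-]; apply/subr0_eq/(orth_of_total aT) => _ [j _ <-].
  by rewrite hdotBr -adjP// !fab ab subrr.
move=> x; rewrite !hnormE; congr (_%:C); apply/eqP.
rewrite -(@eqrXn2 _ 2)// ?hnorm_ge0//; apply/eqP/realC_inj; rewrite -!hnorm_sq.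
by rewrite adjP// -[adj f (f x)]/((fun x => adj f (f x)) x) ff.
Qed.

(** Done without a Neumann series. I - M is bounded below by 1 - r, and a vector z orthogonal to its
    range satisfies |z|^2 = <M z, z> <= r |z|^2, so the range is total and x - M x |-> x extends to
    a bounded inverse. *)
Lemma inverse_of_contraction V (M : V -> V) (r : R) : blinear M -> r < 1 ->
  (forall x, hnorm (M x) <= r * hnorm x) ->
  [/\ blinear (op_inv (fun x => x - M x)),
      forall x, op_inv (fun x => x - M x) (x - M x) = x &
      forall y, op_inv (fun x => x - M x) y - M (op_inv (fun x => x - M x) y) = y].
Proof.
move=> ML r1 Mr.
have FL := blinear_sub (@blinear_id V) ML.
have r10 : 0 < 1 - r by rewrite subr_gt0.
have low x : hnorm x <= (1 - r)^-1 * hnorm (x - M x).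
  rewrite -ler_pdivrMl ?invr_gt0// invrK.
  by have := hnormD (x - M x) (M x); rewrite subrK; have := Mr x; lra.
have aT : cspan (range (fun x => x - M x)) = setT.
  apply: total_of_orth => z zP; apply/hnorm_eq0/eqP; rewrite -sqrf_eq0.
  have : hdot (z - M z) z = 0 by apply: zP; exists z.
  rewrite hdotBl => /subr0_eq; rewrite hnorm_sq => zz.
  have : hnorm z ^+ 2 <= r * hnorm z ^+ 2.
    rewrite -[X in X <= _]cnorm_real ?exprn_ge0 ?hnorm_ge0// zz.
    apply: le_trans (hnorm_cauchy_schwarz _ _) _.
    by rewrite expr2 mulrA ler_wpM2r// hnorm_ge0.
  have : 0 <= hnorm z ^+ 2 by rewrite exprn_ge0// hnorm_ge0.
  move=> z0 zr; apply/eqP/le_anti; rewrite z0 andbT -(pmulr_rle0 _ r10).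
  by rewrite mulrBl mul1r subr_le0.
have bnd n (c : 'I_n -> R[i]) (s : 'I_n -> V) :
    hnorm (\sum_i c i *: s i) <= (1 - r)^-1 * hnorm (\sum_i c i *: (s i - M (s i))).
  have -> : \sum_i c i *: (s i - M (s i)) =
     (\sum_i c i *: s i) - M (\sum_i c i *: s i).
    rewrite (blinear_sum ML) -sumrB; apply: eq_bigr => i _.
    by rewrite (blinearZ ML) scalerBr.
  exact: low.
have r1' : 0 <= (1 - r)^-1 by rewrite invr_ge0 ltW.
have [Rv [RvL RvK _]] := @blinear_extension V V V _ id _ r1' aT bnd.
have RvK' : (fun y => Rv y - M (Rv y)) = id.
  apply: (blinear_ext_total _ (@blinear_id V) aT).
    exact: blinear_comp FL RvL.
  by move=> _ [x _ <-]; rewrite RvK.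
have invE : op_inv (fun x => x - M x) = Rv.
  apply/funext => y; apply: op_inv_eq; first exact: can_inj RvK.
  by rewrite -[LHS]/((fun y => Rv y - M (Rv y)) y) RvK'.
rewrite invE; split=> // y.
by rewrite -[LHS]/((fun y => Rv y - M (Rv y)) y) RvK'.
Qed.

End bounded_linear.

(** * Square roots of positive operators *)

Section positive_square_root.
Context (R : realType) (H : hilbertType R).
Implicit Types (x y : H).

(** The order of [R[i]] makes every <Q x, x> real; polarizing with x + y and x + i y turns this into
    symmetry. *)
Lemma positive_symmetric (Q : H -> H) : blinear Q -> op_le (fun=> 0) Q ->
  forall x y, hdot (Q x) y = hdot x (Q y).
Proof.
move=> QL Qpos.
have Qreal x : hdot (Q x) x = (hdot (Q x) x)^*.
  by have := Qpos x; rewrite hdot0l => /geC0_conj.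
have Qpol x y : hdot (Q x) y + hdot (Q y) x =
    (hdot (Q x) y)^* + (hdot (Q y) x)^*.
  have := Qreal (x + y); rewrite (blinearD QL) !hdotDl !hdotDr !rmorphD /=.
  rewrite -!Qreal => E.
  apply: (addrI (hdot (Q x) x)); apply: (addIr (hdot (Q y) y)).
  by move: E; rewrite !addrA.
move=> x y; rewrite (hdotC x).
have E1 := Qpol x y; have := Qpol x ('i *: y).
rewrite (blinearZ QL) hdotZr hdotZl !rmorphM /= !conjCi.
rewrite !mulNr rmorphN /= conjCi opprK => E2.
have {}E2 : hdot (Q y) x - hdot (Q x) y = (hdot (Q x) y)^* - (hdot (Q y) x)^*.
  apply: (mulfI (neq0Ci _)); rewrite !mulrBr addrC E2; ring.
apply: (@mulfI _ 2); first by rewrite pnatr_eq0.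
rewrite !mulr_natl !mulr2n.
have -> : hdot (Q x) y + hdot (Q x) y =
  (hdot (Q x) y + hdot (Q y) x) - (hdot (Q y) x - hdot (Q x) y) by ring.
rewrite E1 E2; ring.
Qed.

Let half : R[i] := 2^-1.
Let cnorm_half : cnorm half = 2^-1.
Proof.
have -> : half = (2^-1)%:C by rewrite fmorphV rmorph_nat.
by rewrite cnorm_real.
Qed.

Context (B : H -> H) (BL : blinear B).
Hypothesis B_symmetric : forall x y, hdot (B x) y = hdot x (B y).
Hypothesis B_contraction : forall x, hnorm (B x) <= hnorm x.

(* The iteration [Z <- (B + Z^2)/2] increases to [I - (I - B)^(1/2)]; the
   scalar sequence [c n] obtained from [B = 1] bounds [Y n], and bounds the
   increments of [Y n] by its own. *)
Let Y n : H -> H := iter n (fun Z x => half *: (B x + Z (Z x))) (fun=> 0).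
Let c n : R := iter n (fun t => (1 + t ^+ 2) / 2) 0.

Let cS n : c n.+1 = (1 + c n ^+ 2) / 2. Proof. by []. Qed.

Let c_bounds n : 0 <= c n <= 1.
Proof.
elim: n => [|n /andP[c0 c1]]; first by rewrite lexx ler01.
rewrite cS; have : 0 <= c n ^+ 2 by rewrite exprn_ge0.
have : c n ^+ 2 <= 1 by rewrite exprn_ile1.
by move=> ? ?; apply/andP; split; lra.
Qed.

(** The gap t = 1 - c n starts at 1 and evolves by t |-> t - t^2 / 2, a recursion that keeps it
    below 2 / (n + 2). *)
Let c_rate n : (1 - c n) * n.+2%:R <= 2.
Proof.
elim: n => [|n]; first by rewrite /c /= subr0 mul1r.
rewrite cS -[n.+3]addn1 natrD; have /andP[] := c_bounds n.
by move: (c n) n.+2%:R => s t s0 s1 st; rewrite expr2; nra.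
Qed.

Let c_lim (e : R) : 0 < e -> exists N, forall n, (N <= n)%N -> 1 - c n < e.
Proof.
move=> e0; have [|N HN] := @invn_lt R (e / 2); first by rewrite divr_gt0.
exists N => n /HN; rewrite ltr_pdivlMr// => ne; apply: le_lt_trans ne.
rewrite mulrC ler_pdivlMr//; apply: le_trans (c_rate n).
have /andP[_ c1] := c_bounds n.
by rewrite ler_wpM2l ?subr_ge0// ler_nat.
Qed.

Let Y_blinear n : blinear (Y n).
Proof.
elim: n => [|n IHn]; first exact: blinear_cst0.
by apply/blinear_scale/blinear_add => //; exact: blinear_comp.
Qed.

Let Y_symmetric n x y : hdot (Y n x) y = hdot x (Y n y).
Proof.
elim: n x y => [|n IHn] x y /=; first by rewrite hdot0l hdot0r.
rewrite hdotZl hdotZr hdotDl hdotDr B_symmetric !IHn /half.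
by rewrite fmorphV rmorph_nat.
Qed.

Let Y_bound n x : hnorm (Y n x) <= c n * hnorm x.
Proof.
elim: n x => [|n IHn] x /=; first by rewrite hnorm0 mul0r.
rewrite hnormZ cnorm_half mulrC mulrAC ler_pM2r//.
apply: le_trans (hnormD _ _) _; rewrite mulrDl mul1r lerD//.
apply: le_trans (IHn _) _; rewrite expr2 -mulrA ler_wpM2l//.
by case/andP: (c_bounds n).
Qed.

(** With P, Q the iterates n + 1 and n, P^2 - Q^2 = P (P - Q) + (P - Q) Q. The bounds on P, Q and P
    - Q then reproduce the scalar identity for c, in which the two terms add up to the difference of
    the squares. *)
Let Y_step n x : hnorm (Y n.+1 x - Y n x) <= (c n.+1 - c n) * hnorm x.
Proof.
elim: n x => [|n IHn] x.
  rewrite [Y 0 x]/(0 : H) subr0; apply: le_trans (Y_bound 1 x) _.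
  by rewrite /c /= subr0.
rewrite -[Y n.+2 x]/(half *: (B x + Y n.+1 (Y n.+1 x))).
rewrite -[Y n.+1 x in X in _ - X]/(half *: (B x + Y n (Y n x))).
rewrite -scalerBr hnormZ cnorm_half opprD addrACA subrr add0r.
have -> : c n.+2 - c n.+1 = (c n.+1 ^+ 2 - c n ^+ 2) / 2.
  by rewrite !cS; field.
rewrite [leLHS]mulrC mulrAC ler_pM2r//.
rewrite -(subrKA (Y n.+1 (Y n x))) -(blinearB (Y_blinear n.+1)).
apply: le_trans (hnormD _ _) _.
have /andP[c0 c1] := c_bounds n; have /andP[c0' c1'] := c_bounds n.+1.
have cc : 0 <= c n.+1 - c n by rewrite cS; nra.
have h1 : hnorm (Y n.+1 (Y n.+1 x - Y n x)) <= c n.+1 * ((c n.+1 - c n) * hnorm x).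
  by apply: le_trans (Y_bound _ _) _; rewrite ler_wpM2l.
have h2 : hnorm (Y n.+1 (Y n x) - Y n (Y n x)) <= (c n.+1 - c n) * (c n * hnorm x).
  by apply: le_trans (IHn _) _; rewrite ler_wpM2l.
apply: le_trans (lerD h1 h2) _; rewrite le_eqVlt; apply/orP; left; apply/eqP; ring.
Qed.

Let Y_dist n k x : hnorm (Y (k + n) x - Y n x) <= (1 - c n) * hnorm x.
Proof.
apply: (@le_trans _ _ ((c (k + n) - c n) * hnorm x)).
  elim: k => [|k IHk]; first by rewrite add0n !subrr hnorm0 mul0r.
  rewrite addSn; apply: le_trans (hnorm_dist (Y (k + n) x) _ _) _.
  by have := Y_step (k + n) x; lra.
by rewrite ler_wpM2r ?hnorm_ge0// lerD2r; case/andP: (c_bounds (k + n)).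
Qed.

Let Y_cvg x : exists l, hlim (Y ^~ x) l.
Proof.
apply: hcomplete => e e0; have x1 : 0 < hnorm x + 1 by rewrite ltr_wpDl// hnorm_ge0.
have [|N HN] := @c_lim (e / 2 / (hnorm x + 1)); first by rewrite !divr_gt0.
have YN n : (N <= n)%N -> hnorm (Y n x - Y N x) < e / 2.
  move=> Nn; rewrite -(subnK Nn); apply: le_lt_trans (Y_dist _ _ _) _.
  have := HN _ (leqnn N); rewrite ltr_pdivlMr//; apply: le_lt_trans.
  rewrite ler_wpM2l ?lerDl// subr_ge0; by case/andP: (c_bounds N).
exists N => n m /YN h1 /YN; rewrite hnormB => h2.
have := hnorm_dist (Y N x) (Y n x) (Y m x); lra.
Qed.

(** The pointwise limit Z of the iteration satisfies 2 Z = B + Z^2, that is (I - Z)^2 = I - B. It is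
    a symmetric contraction, whence I - Z is positive. *)
Lemma exists_positive_sqrt : exists Q : H -> H,
  [/\ blinear Q, op_le (fun=> 0) Q & forall x, Q (Q x) = x - B x].
Proof.
have [Z Zlim] := choice Y_cvg.
have Y1 n x : hnorm (Y n x) <= hnorm x.
  apply: le_trans (Y_bound _ _) _; rewrite -[leRHS]mul1r ler_wpM2r ?hnorm_ge0//.
  by case/andP: (c_bounds n).
have Zlin a x y : Z (a *: x + y) = a *: Z x + Z y.
  apply: hlim_uniq (Zlim _) _ => e e0.
  have a1 : 0 < cnorm a + 1 by rewrite ltr_wpDl// cnorm_ge0.
  have [|N HN] := Zlim x (e / 2 / (cnorm a + 1)); first by rewrite !divr_gt0.
  have [|N' HN'] := Zlim y (e / 2); first by rewrite divr_gt0.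
  exists (maxn N N') => n; rewrite geq_max => /andP[/HN h /HN' h'].
  rewrite (Y_blinear n).1 opprD addrACA -scalerBr.
  apply: le_lt_trans (hnormD _ _) _; rewrite hnormZ.
  have : cnorm a * hnorm (Y n x - Z x) <= e / 2; last by lra.
  move: h; rewrite ltr_pdivlMr// => /ltW; apply: le_trans.
  by rewrite mulrC ler_wpM2l ?hnorm_ge0// lerDl.
have Z1 x : hnorm (Z x) <= hnorm x.
  apply/ler_addgt0Pr => e /(Zlim x)[N /(_ N (leqnn N)) h].
  have := hnormD (Z x - Y N x) (Y N x); rewrite subrK hnormB; have := Y1 N x; lra.
have ZL : blinear Z by split=> //; exists 1 => // x; rewrite mul1r.
have Zsym x y : hdot (Z x) y = hdot x (Z y).
  apply/subr0_eq/cnorm_eq0/eq0_of_le_eps => [|e e0]; first exact: cnorm_ge0.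
  have y1 : 0 < hnorm y + 1 by rewrite ltr_wpDl// hnorm_ge0.
  have x1 : 0 < hnorm x + 1 by rewrite ltr_wpDl// hnorm_ge0.
  have [|N HN] := Zlim x (e / 2 / (hnorm y + 1)); first by rewrite !divr_gt0.
  have [|N' HN'] := Zlim y (e / 2 / (hnorm x + 1)); first by rewrite !divr_gt0.
  set n := maxn N N'; move: (HN _ (leq_maxl N N')) (HN' _ (leq_maxr N N')).
  rewrite -/n (ltr_pdivlMr _ _ y1) (ltr_pdivlMr _ _ x1) => h h'.
  have -> : hdot (Z x) y - hdot x (Z y) =
     hdot (Z x - Y n x) y + hdot x (Y n y - Z y).
    by rewrite hdotBl hdotBr -Y_symmetric subrKA.
  apply: le_trans (cnormD _ _) _; rewrite [e]splitr; apply: lerD.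
    apply: le_trans (hnorm_cauchy_schwarz _ _) _; apply: (le_trans _ (ltW h)).
    by rewrite hnormB ler_wpM2l ?hnorm_ge0// lerDl.
  apply: le_trans (hnorm_cauchy_schwarz _ _) _; apply: (le_trans _ (ltW h')).
  by rewrite mulrC ler_wpM2l ?hnorm_ge0// lerDl.
have ZE x : Z x = half *: (B x + Z (Z x)).
  apply: (@hlim_uniq _ _ (fun n => Y n.+1 x)) => e e0.
    by have [N HN] := Zlim x e e0; exists N => n Nn; apply: HN; exact: leqW.
  have [N HN] := Zlim x e e0; have [N' HN'] := Zlim (Z x) e e0.
  exists (maxn N N') => n; rewrite geq_max => /andP[/HN h /HN' h'].
  rewrite -[Y n.+1 x]/(half *: (B x + Y n (Y n x))) -scalerBr hnormZ cnorm_half.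
  (* Pointwise convergence passes to the square because [Y n] is a contraction: [Y n (Z x)] is
     inserted between [Y n (Y n x)] and [Z (Z x)]. *)
  rewrite opprD addrACA subrr add0r -(subrKA (Y n (Z x))) -(blinearB (Y_blinear n)).
  have := hnormD (Y n (Y n x - Z x)) (Y n (Z x) - Z (Z x)).
  by have := Y1 n (Y n x - Z x); lra.
exists (fun x => x - Z x); split.
- exact: blinear_sub (@blinear_id _ H) ZL.
- move=> x; rewrite hdot0l hdotBl subr_ge0.
  have /CrealP/RRe_real <- : (hdot (Z x) x)^* = hdot (Z x) x.
    by rewrite -hdotC -Zsym.
  rewrite hnorm_sq lecR; apply: le_trans (ler_norm _) _.
  rewrite -lecR; apply: le_trans (normc_ge_Re _) _; rewrite cnormE lecR.
  apply: le_trans (hnorm_cauchy_schwarz _ _) _.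
  by rewrite expr2 ler_wpM2r ?hnorm_ge0.
- move=> x; rewrite (blinearB ZL).
  have -> : B x = Z x + Z x - Z (Z x).
    rewrite -mulr2n -scaler_nat {1}ZE scalerA mulfV ?pnatr_eq0// scale1r addrK//.
  by rewrite !opprD !addrA opprK.
Qed.

End positive_square_root.

(** * Orthonormal bases and isometries *)

Section hilbert_dimension.
Context (R : realType).
Implicit Types (H U V : hilbertType R).

Lemma orthonormal_setU1 H (E : set H) z : orthonormal_set E ->
  (forall x, E x -> hdot x z = 0) -> z != 0 ->
  exists e, [/\ ~ E e, hdot e e = 1, (forall x, E x -> hdot x e = 0) &
    orthonormal_set (E `|` [set e])].
Proof.
move=> EO Ez z0.
have nz : hnorm z != 0 by apply: contra_neq z0 => /hnorm_eq0.
pose e := ((hnorm z)^-1)%:C *: z.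
have ee : hdot e e = 1.
  rewrite hdotZl hdotZr hnorm_sq conj_Creal ?complex_real//.
  by rewrite -!rmorphM /= expr2 mulKf// mulVf.
have eE x : E x -> hdot x e = 0 by move=> Ex; rewrite hdotZr Ez// mulr0.
have neE x : E x -> x != e.
  move=> Ex; apply/eqP => xe; have := eE _ Ex; rewrite {1}xe ee => /eqP.
  by rewrite oner_eq0.
exists e; split=> //; first by move=> /neE/eqP.
move=> x y [Ex|->] [Ey|->]; first exact: EO.
- by rewrite eE// (negPf (neE _ Ex)).
- by rewrite hdotC eE// rmorph0 eq_sym (negPf (neE _ Ey)).
- by rewrite ee eqxx.
Qed.

Lemma extend_to_hilbert_basis H (E0 : set H) : orthonormal_set E0 ->
  exists2 E, E0 `<=` E & hilbert_basis E.
Proof.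
(* E0 is adjoined inside the predicate so that the empty chain, whose union is empty, also satisfies
   it. *)
move=> E0O; pose P := [set E : set H | orthonormal_set (E `|` E0)].
have [|A [AO Amax]] := @Zorn_bigcup _ P.
  move=> F FP Ftot x y [[X FX Xx]|Ex] [[Y FY Yy]|Ey].
  - have [XY|YX] := Ftot _ _ FX FY.
      by apply: (FP _ FY); left=> //; exact: XY.
    by apply: (FP _ FX); left=> //; exact: YX.
  - by apply: (FP _ FX); [left|right].
  - by apply: (FP _ FY); [right|left].
  - exact: E0O.
exists (A `|` E0); first exact: subsetUr.
split=> //; apply: total_of_orth => z Az; apply/eqP/negP => /negP z0.
have [e [Ae ee eA eO]] := orthonormal_setU1 AO Az z0.
apply: (Amax (A `|` [set e])).
  split; first exact: subsetUl.
  by move=> /(_ e (or_intror erefl)) Ae'; apply: Ae; left.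
by rewrite /P /= -setUA (setUC [set e]) setUA.
Qed.

Lemma exists_hilbert_basis H : exists E : set H, hilbert_basis E.
Proof.
have [|E _ EB] := @extend_to_hilbert_basis H set0; last by exists E.
by move=> x y [].
Qed.

Lemma orthonormal_image U V (G : U -> V) (E : set U) : blinear G ->
  isometric G -> orthonormal_set E -> orthonormal_set (G @` E).
Proof.
move=> GL GI EO _ _ [x Ex <-] [y Ey <-]; rewrite isometric_hdot// EO//.
congr ((nat_of_bool _)%:R); apply/eqP/eqP => [->//|].
by move=> /(congr1 (adj G)); rewrite !isometric_adjK.
Qed.

(** The image of a basis is orthonormal but perhaps not total, so it is completed to a basis of
    V. *)
Lemma hdim_le_of_isometry U V (G : U -> V) : blinear G -> isometric G ->
  hdim_le U V.
Proof.
move=> GL GI; have [E EB] := exists_hilbert_basis U.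
have [F GF FB] := extend_to_hilbert_basis (orthonormal_image GL GI EB.1).
exists E, F; split=> //; apply: card_le_trans (subset_card_le GF).
have : (G @` E #= E)%card; last by rewrite card_eq_le => /andP[].
by apply: inj_card_eq => x y _ _ /(congr1 (adj G)); rewrite !isometric_adjK.
Qed.

Lemma isometry_of_basis_injection U V (E : set U) (F : set V) (phi : U -> V) :
  hilbert_basis E -> orthonormal_set F -> set_fun E F phi -> set_inj E phi ->
  exists G : 'L(U, V), isometric G /\ forall x, E x -> G x = phi x.
Proof.
move=> [EO ET] FO EF phiI.
pose a (i : {x | E x}) := proj1_sig i; pose b i := phi (a i).
have aE : range a = E.
  by apply/seteqP; split=> [_ [[x Ex] _ <-]//|x Ex]; exists (exist _ x Ex).
have [||f [fL fab fI]] := @gram_extension _ _ U V a b; first by rewrite aE.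
  move=> [x Ex] [y Ey]; rewrite /b /a /= FO ?EO//; try exact: EF.
  congr ((nat_of_bool _)%:R); apply/eqP/eqP => [|->//].
  by apply: phiI; rewrite inE.
have [G GE] := blinear_op fL; exists G; split.
  by move=> x; rewrite GE.
by move=> x Ex; rewrite GE (fab (exist _ x Ex)).
Qed.

Lemma isometry_of_hdim_le U V : hdim_le U V ->
  exists G : 'L(U, V), isometric G.
Proof.
move=> [E [F [EB [FO FT] /pcard_leP[f]]]].
have [||G [GI _]] := isometry_of_basis_injection (phi := f) EB FO; last by exists G.
  by move=> x Ex; exact: funS.
exact: inj.
Qed.

Lemma unitary_of_adjK U V (G : U -> V) : isometric G ->
  (forall y, G (adj G y) = y) -> unitary G.
Proof. by move=> GI GK; split=> // y; exists (adj G y). Qed.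

Lemma unitary_adjK U V (G : U -> V) : blinear G -> unitary G ->
  forall y, G (adj G y) = y.
Proof.
by move=> GL [GI GO] y; have [x <-] := GO y; rewrite isometric_adjK.
Qed.

Lemma unitary_of_total U V (G : U -> V) (E : set U) : blinear G ->
  isometric G -> cspan (G @` E) = setT -> unitary G.
Proof.
move=> GL GI GT; apply: unitary_of_adjK => // y.
suff /(congr1 (@^~ y)) : (fun y => G (adj G y)) = id by [].
apply: (blinear_ext_total _ (@blinear_id _ V) GT).
  by apply: blinear_comp => //; exact: adj_blinear.
by move=> _ [x _ <-]; rewrite isometric_adjK.
Qed.

Lemma unitary_of_hdim_eq U V : hdim_eq U V ->
  exists G : 'L(U, V), unitary G.
Proof.
move=> [E [F [EB [FO FT] /card_set_bijP[f [fun_f inj_f surj_f]]]]].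
have [G [GI Gf]] := isometry_of_basis_injection EB FO fun_f inj_f.
exists G; apply: (unitary_of_total (E := E)) => //; first exact: op_blinear.
suff -> : G @` E = F by [].
apply/seteqP; split=> [_ [x Ex <-]|y /surj_f[x Ex <-]].
  by rewrite Gf//; exact: fun_f.
by exists x => //; rewrite Gf.
Qed.

Lemma bessel H (s : seq H) (x : H) : uniq s -> orthonormal_set [set` s] ->
  \sum_(e <- s) hdot x e * (hdot x e)^* <= hdot x x.
Proof.
move=> su sO; set p := \sum_(e <- s) hdot x e *: e.
have px e : e \in s -> hdot p e = hdot x e.
  move=> es; rewrite hdot_suml (bigD1_seq e)//= big1_seq ?addr0.
    by rewrite hdotZl (sO e e)// eqxx mulr1.
  by move=> f /andP[fe fs]; rewrite hdotZl (sO f e)// (negPf fe) mulr0.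
have xp : hdot x p = \sum_(e <- s) hdot x e * (hdot x e)^*.
  by rewrite hdot_sumr; apply: eq_bigr => e _; rewrite hdotZr mulrC.
have pp : hdot p p = hdot x p.
  rewrite {2}/p {2}/p !hdot_sumr; apply: eq_big_seq => e es.
  by rewrite !hdotZr px.
have px' : hdot p x = hdot x p.
  by rewrite hdotC -pp {1}hdotC conjCK pp.
rewrite -xp -subr_ge0.
have -> : hdot x x - hdot x p = hdot (x - p) (x - p).
  by rewrite hdotBl !hdotBr px' pp subrr subr0.
by rewrite hnorm_sq lecR exprn_ge0// hnorm_ge0.
Qed.

Lemma parseval H (s : seq H) (x : H) : uniq s -> hilbert_basis [set` s] ->
  \sum_(e <- s) hdot x e * (hdot x e)^* = hdot x x.
Proof.
move=> su [sO sT]; set p := \sum_(e <- s) hdot x e *: e.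
have -> : \sum_(e <- s) hdot x e * (hdot x e)^* = hdot x p.
  by rewrite hdot_sumr; apply: eq_bigr => e _; rewrite hdotZr mulrC.
suff /subr0_eq <- : x - p = 0 by [].
apply: (orth_of_total sT) => e es.
rewrite hdotBr hdot_sumr (bigD1_seq e)//= big1_seq ?addr0.
  by rewrite hdotZr (sO e e)// eqxx mulr1 -hdotC subrr.
by move=> f /andP[fe fs]; rewrite hdotZr (sO e f)// eq_sym (negPf fe) mulr0.
Qed.

(** Double counting of the sum of |<f, e>|^2 over f in t and e in s: summing over e first gives the
    size of t by Parseval, summing over f first gives at most the size of s by Bessel. *)
Lemma orthonormal_size_le H (s t : seq H) : uniq s -> hilbert_basis [set` s] ->
  uniq t -> orthonormal_set [set` t] -> (size t <= size s)%N.
Proof.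
move=> su sB tu tO; rewrite -(@ler_nat R[i]).
have sizeE (r : seq H) : orthonormal_set [set` r] ->
    (size r)%:R = \sum_(e <- r) hdot e e.
  move=> rO; rewrite (eq_big_seq (fun=> 1)); last by move=> e er; rewrite rO//= eqxx.
  by rewrite big_const_seq count_predT iter_addr_0.
rewrite (sizeE t tO) (sizeE s sB.1).
under eq_bigr => f _ do rewrite -(parseval f su sB).
rewrite exchange_big /=; apply: ler_sum => e _.
apply: le_trans (bessel e tu tO); apply: ler_sum => f _.
by rewrite (hdotC f e) conjCK mulrC.
Qed.

Lemma finite_uniq_seq (T : eqType) (A : set T) : finite_set A ->
  exists2 s : seq T, uniq s & A = [set` s].
Proof.
move=> /finite_seqP[s ->]; exists (undup s); first exact: undup_uniq.
by apply/seteqP; split=> x /=; rewrite mem_undup.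
Qed.

(** [hdim_finite] and [hdim_eq] may speak of different bases of the same space; this carries
    finiteness from one to the other. *)
Lemma orthonormal_finite H (F : set H) : hdim_finite H -> orthonormal_set F ->
  finite_set F.
Proof.
move=> [E [EB /finite_uniq_seq[s su sE]]] FO.
have [//|Finf] := pselect (finite_set F).
have [B BF sB] := infinite_set_fset (size s).+1 Finf.
rewrite sE in EB.
have BO : orthonormal_set [set` finmap.enum_fset B] by move=> x y /BF Fx /BF; exact: FO.
by have := orthonormal_size_le su EB (finmap.fset_uniq B) BO; rewrite leqNgt sB.
Qed.

(** If the image of a basis of U were not total, one more unit vector would give an orthonormal list
    in V longer than a basis of V. *)
Lemma finite_isometry_unitary U V (G : U -> V) : hdim_eq U V -> hdim_finite V ->
  blinear G -> isometric G -> unitary G.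
Proof.
move=> [E [F [EB FB EF]]] Vfin GL GI.
have /finite_uniq_seq[s su sF] := orthonormal_finite Vfin FB.1.
move: EF; rewrite card_eq_sym => /card_set_bijP[f [fun_f inj_f surj_f]].
rewrite sF in FB fun_f inj_f surj_f.
have GO : orthonormal_set (G @` E) by exact: orthonormal_image EB.1.
pose t := map (fun x => G (f x)) s.
have Gf x : x \in s -> (G @` E) (G (f x)).
  by move=> xs; exists (f x) => //; exact: fun_f.
have tE : [set` t] = G @` E.
  apply/seteqP; split=> [_ /= /mapP[x xs ->]|_ [x Ex <-]]; first exact: Gf.
  by have [y ys <-] := surj_f _ Ex; apply/mapP; exists y.
have tu : uniq t.
  rewrite map_inj_in_uniq// => x y xs ys /(congr1 (adj G)).
  by rewrite !isometric_adjK// => /inj_f; apply; rewrite inE.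
apply: (unitary_of_total (E := E)) => //; apply: total_of_orth => z zP.
apply/eqP/negP => /negP z0; have [e [Ge _ _ eO]] := orthonormal_setU1 GO zP z0.
have := @orthonormal_size_le _ s (e :: t) su FB.
rewrite /= tu size_map ltnn andbT => h; apply/notF/h.
  by apply/negP => et; apply: Ge; rewrite -tE.
suff -> : [set` e :: t] = G @` E `|` [set e] by [].
rewrite -tE; apply/seteqP; split=> x /=.
  by rewrite in_cons => /orP[/eqP->|]; [right|left].
by case=> [xt|->]; rewrite in_cons ?eqxx// xt orbT.
Qed.

End hilbert_dimension.

(** * Fock space *)

Section completeness_by_sequences.
Context (R : realType) (V : normedModType R[i]).
Hypothesis V_seq_complete : forall u : nat -> V,
  (forall e : R, 0 < e -> exists N, forall n m, (N <= n)%N -> (N <= m)%N ->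
    `|u n - u m| < e%:C) ->
  exists l, forall e : R, 0 < e -> exists N, forall n, (N <= n)%N ->
    `|u n - l| < e%:C.

(** A Cauchy filter contains a ball of radius 1 / (n + 1) for each n. Any two of these balls meet,
    so their centres form a Cauchy sequence, and the filter converges to its limit. *)
Lemma complete_of_sequences (F : set_system V) : ProperFilter F -> cauchy F ->
  cvg F.
Proof.
move=> FF /cauchyP Fc.
have /choice[u uF] : forall n, exists x, F (ball x (n.+1%:R^-1 : R)%:C).
  by move=> n; apply: Fc; rewrite ltcR.
have uu n m : `|u n - u m| < (n.+1%:R^-1 + m.+1%:R^-1 : R)%:C.
  have [x [/=]] := filter_ex (filterI (uF n) (uF m)).
  rewrite -!ball_normE /= => nx mx; rewrite realCD.
  apply: le_lt_trans (ler_distD x _ _) _; rewrite ltrD//.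
  by rewrite distrC.
have [l ul] : exists l, forall e : R, 0 < e -> exists N, forall n, (N <= n)%N ->
    `|u n - l| < e%:C.
  apply: V_seq_complete => e e0.
  have [|N HN] := @invn_lt R (e / 2); first by rewrite divr_gt0.
  exists N => n m /HN Nn /HN Nm; apply: lt_trans (uu n m) _.
  by rewrite ltcR [e]splitr ltrD.
apply/cvg_ex; exists l; apply/cvgrPdist_lt => _ /pos_realC[e e0 ->].
have e20 : 0 < e / 2 by rewrite divr_gt0.
have [N HN] := ul _ e20; have [N' HN'] := invn_lt e20.
have := HN _ (leq_maxl N N'); have := HN' _ (leq_maxr N N').
move: (maxn N N') => n ne nl; near=> x.
have : ball (u n) (n.+1%:R^-1 : R)%:C x by near: x; exact: uF.
rewrite -ball_normE /= => nx; rewrite [e]splitr realCD.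
apply: le_lt_trans (ler_distD (u n) _ _) _; rewrite ltrD//.
  by rewrite distrC.
by apply: lt_trans nx _; rewrite ltcR.
Unshelve. all: by end_near. Qed.
End completeness_by_sequences.

(** * Limits of complex sequences *)

Section complex_limits.
Context (R : realType).
Implicit Types (u v : nat -> R[i]) (a l : R[i]).

Definition clim u l : Prop := forall e : R, 0 < e ->
  exists N, forall n, (N <= n)%N -> cnorm (u n - l) < e.

Lemma cnormN a : cnorm (- a) = cnorm a.
Proof. by rewrite /cnorm normrN. Qed.

Lemma clim_uniq u l l' : clim u l -> clim u l' -> l = l'.
Proof.
move=> ul ul'; apply/subr0_eq/cnorm_eq0/eq0_of_le_eps => [|e e0]; first exact: cnorm_ge0.
have e20 : 0 < e / 2 by rewrite divr_gt0.
have [N HN] := ul _ e20; have [N' HN'] := ul' _ e20.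
have := HN (maxn N N') (leq_maxl _ _); have := HN' (maxn N N') (leq_maxr _ _).
rewrite -(cnormN (_ - l)) opprB => h1 h2.
have := cnormD (l - u (maxn N N')) (u (maxn N N') - l').
by rewrite subrKA; lra.
Qed.

Lemma clim_lin a u v l l' : clim u l -> clim v l' ->
  clim (fun n => a * u n + v n) (a * l + l').
Proof.
move=> ul vl e e0.
have a1 : 0 < cnorm a + 1 by rewrite ltr_wpDl// cnorm_ge0.
have [|N HN] := ul (e / 2 / (cnorm a + 1)); first by rewrite !divr_gt0.
have [|N' HN'] := vl (e / 2); first by rewrite divr_gt0.
exists (maxn N N') => n; rewrite geq_max => /andP[/HN h /HN' h'].
rewrite opprD addrACA -mulrBr; apply: le_lt_trans (cnormD _ _) _; rewrite cnormM.
have : cnorm a * cnorm (u n - l) <= e / 2; last by lra.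
move: h; rewrite ltr_pdivlMr// => /ltW; apply: le_trans.
by rewrite mulrC ler_wpM2l ?cnorm_ge0// lerDl.
Qed.

Lemma clim_cst a : clim (fun=> a) a.
Proof.
by move=> e e0; exists 0%N => n _; rewrite subrr cnorm_real.
Qed.

Lemma clim_conj u l : clim u l -> clim (fun n => (u n)^*) l^*.
Proof.
move=> ul e /ul[N HN]; exists N => n /HN.
by rewrite -rmorphB /= cnormC.
Qed.

Lemma clim_le (r : nat -> R) (l b : R) : clim (fun n => (r n)%:C) l%:C ->
  (forall n, r n <= b) -> l <= b.
Proof.
move=> rl rb; apply/ler_addgt0Pr => e /rl[N /(_ N (leqnn N))].
rewrite -rmorphB /= /cnorm normc_def /= expr0n addr0 sqrtr_sqr /= => h.
have := rb N; have := ler_norm (l - r N); rewrite distrC; lra.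
Qed.

Lemma clim_monotone (r : nat -> R) (b : R) :
  (forall n, r n <= r n.+1) -> (forall n, r n <= b) ->
  exists2 l, clim (fun n => (r n)%:C) l%:C & forall n, r n <= l.
Proof.
move=> rS rb.
have rle n m : (n <= m)%N -> r n <= r m.
  move=> /subnKC <-; elim: (m - n)%N => [|k IHk]; first by rewrite addn0.
  by rewrite addnS (le_trans IHk).
have Rsup : has_sup (range r).
  by split; [exists (r 0%N), 0%N|exists b => _ [n _ <-]].
have rsup n : r n <= sup (range r) by apply: sup_ubound; [case: Rsup|exists n].
exists (sup (range r)) => // e e0.
have [_ [N _ <-] rN] := sup_adherent e0 Rsup.
exists N => n /rle Nn; rewrite -cnormN -rmorphB -rmorphN /= opprB cnorm_real ?subr_ge0//.
by rewrite ltrBlDl -ltrBlDr; apply: lt_le_trans rN Nn.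
Qed.

Lemma clim_expr (q : R[i]) : cnorm q < 1 -> clim (fun n => q ^+ n) 0.
Proof.
move=> q1 e e0; have := @cvg_expr R (cnorm q).
rewrite ger0_norm ?cnorm_ge0// => /(_ q1)/cvgrPdist_lt/(_ e e0)[N _ HN].
exists N => n /HN /=; rewrite sub0r normrN subr0.
rewrite (_ : cnorm (q ^+ n) = cnorm q ^+ n) => [h|].
  exact: le_lt_trans (ler_norm _) h.
by apply: realC_inj; rewrite rmorphXn /= -!cnormE normrX.
Qed.
End complex_limits.

(** A separate name for the scalars, to carry the inner product structure; as coefficient space it
    yields the scalar space H(k_d). *)
Definition complex_line (R : realType) : Type := R[i].

Section complex_line.
Context (R : realType).
HB.instance Definition _ := GRing.Lmodule.copy (complex_line R) (R[i]^o).

Let dot (x y : complex_line R) : R[i] := (x : R[i]) * (y : R[i])^*.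
Let dot_linearl (a : R[i]) (x y z : complex_line R) :
  dot (a *: x + y) z = a * dot x z + dot y z.
Proof. by rewrite /dot [_ *: _]/(a * (x : R[i])) mulrDl mulrA. Qed.
Let dotC x y : dot x y = (dot y x)^*.
Proof. by rewrite /dot rmorphM /= conjCK mulrC. Qed.
Let dot_ge0 x : 0 <= dot x x.
Proof. by rewrite /dot -normCK exprn_ge0. Qed.
Let dot_eq0 x : dot x x = 0 -> x = 0.
Proof. by move/eqP; rewrite /dot -normCK expf_eq0 /= normr_eq0 => /eqP. Qed.
HB.instance Definition _ := Lmodule_isPreHilbert.Build R (complex_line R)
  dot_linearl dotC dot_ge0 dot_eq0.

Lemma complex_line_norm (x : complex_line R) : `|x| = `|x : R[i]|.
Proof.
apply/eqP; rewrite -(@eqrXn2 _ 2)// -hdot_norm normCK; exact/eqP.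
Qed.

Let complete (F : set_system (complex_line R)) : ProperFilter F -> cauchy F ->
  cvg F.
Proof.
apply: complete_of_sequences => u uC.
have cauchy_part (f : R[i] -> R) : (forall x y, f (x - y) = f x - f y) ->
    (forall x, (`|f x|)%:C <= `|x|) -> exists l, forall e : R, 0 < e ->
    exists N, forall n, (N <= n)%N -> `|f (u n) - l| < e.
  move=> fB f1; have fcvg : cvg ((fun n => f (u n)) @ \oo).
    apply: cauchy_cvg; apply: cauchy_exP => e /uC[N HN].
    exists (f (u N)); exists N => // n /= Nn; rewrite -ball_normE /= -fB -ltcR.
    apply: le_lt_trans (f1 _) _; rewrite -complex_line_norm.
    exact: HN.
  exists (lim ((fun n => f (u n)) @ \oo)) => e e0.
  have /cvgrPdist_lt/(_ e e0)[N _ HN] := fcvg.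
  by exists N => n /HN /=; rewrite distrC.
have [||a ua] := cauchy_part (@complex.Re R); [by case=> ? ? []|exact: normc_ge_Re|].
have [||b ub] := cauchy_part (@complex.Im R); [by case=> ? ? []| |].
  move=> x; rewrite normc_def lecR -[leLHS]sqrtr_sqr ler_wsqrtr//.
  by rewrite lerDr sqr_ge0.
exists (Complex a b) => e e0; have e20 : 0 < e / 2 by rewrite divr_gt0.
have [N HN] := ua _ e20; have [N' HN'] := ub _ e20.
exists (maxn N N') => n; rewrite geq_max => /andP[/HN h /HN' h'].
rewrite complex_line_norm; move: (u n) h h' => [x y] /= h h'.
have -> : Complex x y - Complex a b = (x - a)%:C + 'i * (y - b)%:C.
  by rewrite -complexiE; simpc.
have normR (r : R) : `|r%:C| = (`|r|)%:C :> R[i].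
  by rewrite normc_def /= expr0n addr0 sqrtr_sqr.
have := ler_normD ((x - a)%:C : R[i]) ('i * (y - b)%:C).
rewrite normrM normCi mul1r (normR (x - a)) (normR (y - b)) => xy.
by apply: le_lt_trans xy _; rewrite -realCD ltcR [e]splitr ltrD.
Qed.
HB.instance Definition _ := Uniform_isComplete.Build (complex_line R) complete.
End complex_line.

(** * Square-summable families indexed by words *)

Section fock_space.
Context (R : realType) (d : nat) (Y : hilbertType R).
Local Notation word := (seq 'I_d).
Implicit Types (x y z : word -> Y).

Fixpoint words n : seq word :=
  if n is m.+1 then [seq j :: w | j <- enum 'I_d, w <- words m] else [:: [::]].

Lemma mem_words (w : word) : w \in words (size w).
Proof.
elim: w => [|j w IHw] //=; apply/allpairsP; exists (j, w).
by rewrite mem_enum.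
Qed.

(** Exhausting the words by length turns sums over all words into limits of sequences, and groups
    the terms of the kernel by degree. *)
Fixpoint words_below n : seq word :=
  if n is m.+1 then words_below m ++ words m else [::].

Definition partial_sq x n : R := \sum_(w <- words_below n) hnorm (x w) ^+ 2.

Definition partial_dot x y n : R[i] := \sum_(w <- words_below n) hdot (x w) (y w).

Lemma partial_sqS x n : partial_sq x n <= partial_sq x n.+1.
Proof.
rewrite /partial_sq /= big_cat lerDl; apply: sumr_ge0 => w _.
by rewrite exprn_ge0// hnorm_ge0.
Qed.

Lemma partial_dotxx x n : partial_dot x x n = (partial_sq x n)%:C.
Proof. by rewrite rmorph_sum; apply: eq_bigr => w _; rewrite hnorm_sq. Qed.

Definition square_summable x : Prop := exists M, forall n, partial_sq x n <= M.

Definition in_fock : {pred (word -> Y)} := fun x => `[< square_summable x >].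

Lemma fock_submod : submod_closed in_fock.
Proof.
split=> [|a x y].
  apply/asboolP; exists 0 => n; rewrite /partial_sq big1// => w _.
  by rewrite hnorm0 expr0n.
rewrite !unfold_in => /asboolP[M xM] /asboolP[N yN]; apply/asboolP.
exists (2 * (cnorm a ^+ 2 * M + N)) => n.
apply: (@le_trans _ _ (2 * (cnorm a ^+ 2 * partial_sq x n + partial_sq y n))).
  rewrite /partial_sq !mulr_sumr -big_split mulr_sumr; apply: ler_sum => w _ /=.
  have -> : (a *: x + y) w = a *: x w + y w by [].
  have := parallelogram (a *: x w) (y w); rewrite hnormZ exprMn.
  by have := sqr_ge0 (hnorm (a *: x w - y w)); lra.
by rewrite ler_pM2l// lerD// ler_wpM2l// sqr_ge0.
Qed.
HB.instance Definition _ :=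
  GRing.isSubmodClosed.Build _ _ in_fock fock_submod.

Record fock : Type := Fock { fock_val :> word -> Y; fock_valP : fock_val \in in_fock }.

HB.instance Definition _ := [isSub for fock_val].
HB.instance Definition _ := [Choice of fock by <:].
HB.instance Definition _ := [SubChoice_isSubLmodule of fock by <:].

Let dot (x y : fock) : R[i] := xget 0 [set l | clim (partial_dot x y) l].

Lemma fock_sq_lim (x : fock) : exists2 l : R,
  clim (partial_dot x x) l%:C & forall n, partial_sq x n <= l.
Proof.
have /asboolP[M xM] := fock_valP x.
have [l xl ln] := clim_monotone (partial_sqS x) xM; exists l => //.
have -> // : partial_dot x x = fun n => (partial_sq x n)%:C.
by apply/funext => n; exact: partial_dotxx.
Qed.

Lemma hdot_polarization (u v : Y) : hdot u v = 4^-1 *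
  (hdot (u + v) (u + v) + ((- 1) * hdot (u - v) (u - v) +
   ('i * hdot (u + 'i *: v) (u + 'i *: v) +
    (- 'i) * hdot (u - 'i *: v) (u - 'i *: v)))).
Proof.
rewrite !hdotDl !hdotDr !hdotNl !hdotNr !hdotZl !hdotZr conjCi.
apply: (@mulfI _ 4); first by rewrite pnatr_eq0.
rewrite mulVKf ?pnatr_eq0//.
have ii : 'i * 'i = -1 :> R[i] by rewrite -expr2 sqrCi.
ring: ii.
Qed.

(** Sums of squares converge because they are monotone and bounded; polarization writes
    [partial_dot x y] as a combination of four of them. *)
Let dotP (x y : fock) : clim (partial_dot x y) (dot x y).
Proof.
rewrite /dot; case: xgetP => [//|noL]; exfalso.
have [a xa _] := fock_sq_lim (x + y); have [b xb _] := fock_sq_lim (x - y).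
have [c xc _] := fock_sq_lim (x + 'i *: y).
have [e xe _] := fock_sq_lim (x - 'i *: y).
have := clim_lin (- 'i) xe (clim_cst 0); move=> /(clim_lin 'i xc).
move=> /(clim_lin (-1) xb)/(clim_lin 1 xa) lim0.
have := clim_lin 4^-1 lim0 (clim_cst 0).
set l := (X in clim _ X) => xyl; apply: (noL l); move: xyl.
congr clim; apply/funext => n; rewrite !addr0 mul1r.
rewrite /partial_dot [RHS](eq_bigr _ (fun w _ => hdot_polarization _ _)).
by rewrite -mulr_sumr !big_split -!mulr_sumr.
Qed.

Let dot_linearl (a : R[i]) (x y z : fock) :
  dot (a *: x + y) z = a * dot x z + dot y z.
Proof.
apply: clim_uniq (dotP _ _) _; have := clim_lin a (dotP x z) (dotP y z).
congr clim; apply/funext => n; rewrite /partial_dot mulr_sumr -big_split.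
by apply: eq_bigr => w _; exact/esym/hdot_linearl.
Qed.

Let dotC (x y : fock) : dot x y = (dot y x)^*.
Proof.
apply: clim_uniq (dotP _ _) _; have := clim_conj (dotP y x).
congr clim; apply/funext => n; rewrite /partial_dot rmorph_sum.
by apply: eq_bigr => w _; exact/esym/hdotC.
Qed.

Let dot_ge (x : fock) n : (partial_sq x n)%:C <= dot x x.
Proof.
have [l xl ln] := fock_sq_lim x.
by rewrite (clim_uniq (dotP x x) xl) lecR.
Qed.

Let dot_ge0 (x : fock) : 0 <= dot x x.
Proof. by have := dot_ge x 0; rewrite /partial_sq big_nil. Qed.

Lemma word_sq_le (z : word -> Y) (w : word) :
  hnorm (z w) ^+ 2 <= partial_sq z (size w).+1.
Proof.
rewrite /partial_sq /= big_cat /= ler_wpDl//.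
  by apply: sumr_ge0 => v _; rewrite exprn_ge0// hnorm_ge0.
rewrite (big_rem w) ?mem_words//= lerDl.
by apply: sumr_ge0 => v _; rewrite exprn_ge0// hnorm_ge0.
Qed.

Let dot_eq0 (x : fock) : dot x x = 0 -> x = 0.
Proof.
move=> x0; apply/val_inj/funext => w; apply/hnorm_eq0/eqP; rewrite -sqrf_eq0.
apply/eqP/le_anti; rewrite sqr_ge0 andbT -lecR -[leRHS]/(0 : R[i]) -x0.
by apply: le_trans (dot_ge x (size w).+1); rewrite lecR word_sq_le.
Qed.
HB.instance Definition _ := Lmodule_isPreHilbert.Build R fock
  dot_linearl dotC dot_ge0 dot_eq0.

Lemma fock_hdotP (x y : fock) : clim (partial_dot x y) (hdot x y).
Proof. exact: dotP. Qed.

Lemma fock_norm_ge (x : fock) n : (partial_sq x n)%:C <= `|x| ^+ 2.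
Proof. by rewrite -hdot_norm; exact: dot_ge. Qed.

Lemma fock_norm_le (x : fock) (M : R) : (forall n, partial_sq x n <= M) ->
  `|x| ^+ 2 <= M%:C.
Proof.
move=> xM; have [l xl _] := fock_sq_lim x.
rewrite -hdot_norm (clim_uniq (fock_hdotP x x) xl) lecR.
apply: clim_le xM; move: xl; congr clim; apply/funext => n.
exact: partial_dotxx.
Qed.

(** Makes [partial_sq] the square of a Hilbert space norm, so that the triangle inequality applies
    to truncations. *)
Let restrict n (x : word -> Y) : hpow Y (size (words_below n)) :=
  [ffun i : 'I__ => x (nth [::] (words_below n) i)].

Let restrict_sq n x : hnorm (restrict n x) ^+ 2 = partial_sq x n.
Proof.
rewrite hpow_hnorm /partial_sq (big_nth [::]) big_mkord.
by apply: eq_bigr => i _; rewrite ffunE.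
Qed.

Let restrictB n x y : restrict n (x - y) = restrict n x - restrict n y.
Proof. by apply/ffunP => i; rewrite !ffunE. Qed.

Let complete (F : set_system fock) : ProperFilter F -> cauchy F -> cvg F.
Proof.
apply: complete_of_sequences => u uC.
have rC (e : R) : 0 < e -> exists N, forall n m, (N <= n)%N -> (N <= m)%N ->
    forall k, hnorm (restrict k (u n) - restrict k (u m)) < e.
  move=> e0; have [N HN] := uC e e0; exists N => n m /HN h /h {}h k.
  rewrite -restrictB -(@ltr_pXn2r _ 2)// ?nnegrE ?hnorm_ge0 ?(ltW e0)//.
  rewrite restrict_sq -ltcR; apply: le_lt_trans (fock_norm_ge (u n - u m) k) _.
  by rewrite rmorphXn /= ltr_pXn2r ?nnegrE ?lecR ?(ltW e0).
have /choice[l ul] : forall w, exists l, hlim (fun n => u n w : Y) l.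
  move=> w; apply: hcomplete => e /rC[N HN]; exists N => n m Nn Nm.
  apply: le_lt_trans (HN n m Nn Nm (size w).+1).
  rewrite -(@ler_pXn2r _ 2)// ?nnegrE ?hnorm_ge0// -restrictB restrict_sq.
  exact: (word_sq_le ((u n : word -> Y) - u m)).
have rlim k : hlim (fun n => restrict k (u n)) (restrict k l).
  move=> e e0.
  have e1 : 0 < e / (size (words_below k)).+1%:R by rewrite divr_gt0.
  have /choice[N HN] := fun i : 'I_(size (words_below k)) =>
    ul (nth [::] (words_below k) i) _ e1.
  exists (\max_i N i)%N => n Nn.
  rewrite -ltcR -hnormE; apply: le_lt_trans (hpow_norm_le _) _.
  apply: (@le_lt_trans _ _ (\sum_(i < size (words_below k))
      (e / (size (words_below k)).+1%:R)%:C)).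
    apply: ler_sum => i _; rewrite hnormE lecR -restrictB ffunE; apply/ltW.
    apply: (HN i); apply: leq_trans Nn; exact: leq_bigmax.
  rewrite -rmorph_sum ltcR sumr_const card_ord -[ltLHS]mulr_natr -mulrA.
  by rewrite gtr_pMr// mulrC ltr_pdivrMr// mul1r ltr_nat.
(* N does not depend on the truncation k: the Cauchy estimate is uniform in k, and for each k the
   second index is sent to infinity. This gives both membership of l and convergence in norm. *)
have uB (e : R) : 0 < e -> exists N, forall n, (N <= n)%N ->
    forall k, partial_sq (fun w => u n w - l w) k <= e ^+ 2.
  move=> e0; have [N HN] := rC e e0; exists N => n Nn k.
  rewrite -restrict_sq lerXn2r ?nnegrE ?hnorm_ge0 ?(ltW e0)//.
  rewrite -[fun _ => _]/((u n : word -> Y) - l) restrictB.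
  apply/ler_addgt0Pr => e' /(rlim k)[N' HN'].
  have := HN' _ (leq_maxr N N'); have := HN _ _ Nn (leq_maxl N N') k.
  have := hnorm_dist (restrict k (u (maxn N N'))) (restrict k (u n)) (restrict k l).
  by move=> h1 h2 h3; apply: le_trans h1 _; rewrite lerD// ltW.
have lF : l \in in_fock.
  have [N HN] := uB 1 ltr01.
  have dF : (fun w => u N w - l w) \in in_fock.
    by apply/asboolP; exists (1 ^+ 2) => k; exact: HN.
  have -> : l = (u N : word -> Y) - (fun w => u N w - l w).
    by apply/funext => w; rewrite -[RHS]/(u N w - (u N w - l w)) opprB addrC subrK.
  by rewrite rpredB// fock_valP.
exists (Fock lF) => e e0; have e20 : 0 < e / 2 by rewrite divr_gt0.
have [N HN] := uB _ e20; exists N => n /HN h.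
have := @fock_norm_le (u n - Fock lF) _ h.
rewrite rmorphXn /= ler_pXn2r ?nnegrE// ?lecR ?(ltW e20)// => h'.
by apply: le_lt_trans h' _; rewrite ltcR; lra.
Qed.
HB.instance Definition _ := Uniform_isComplete.Build fock complete.
End fock_space.

(** * The kernel spaces and their multipliers *)

Section unit_ball.
Context (R : realType) (d : nat).
Implicit Types (l z : unit_ball R d).

Let point l : hpow (complex_line R) d := [ffun j => l 0 j : complex_line R].

Let cdotE l z : cdot l z = hdot (point l) (point z).
Proof.
rewrite hpow_hdot; apply: eq_bigr => j _; by rewrite !ffunE.
Qed.

Lemma ball_coord_sq l : (\sum_j cnorm (l 0 j) ^+ 2)%:C = cdot l l.
Proof. by rewrite rmorph_sum; apply: eq_bigr => j _; exact/esym/cnorm_sq. Qed.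

Lemma ball_sq_lt1 l : \sum_j cnorm (l 0 j) ^+ 2 < 1.
Proof. by rewrite -ltcR ball_coord_sq; exact: ball_valP. Qed.

Lemma cdot_lt1 l z : cnorm (cdot l z) < 1.
Proof.
have n1 v : hnorm (point v) < 1.
  rewrite -(@ltr_pXn2r _ 2)// ?nnegrE ?hnorm_ge0// expr1n.
  by rewrite -ltcR -hnorm_sq -cdotE; exact: ball_valP.
rewrite cdotE; apply: le_lt_trans (hnorm_cauchy_schwarz _ _) _.
by rewrite -[ltRHS]mul1r ltr_pM ?hnorm_ge0.
Qed.

Lemma one_sub_cdot_neq0 l z : 1 - cdot l z != 0.
Proof.
rewrite subr_eq0; apply/eqP => h; have := cdot_lt1 l z.
by rewrite -h cnorm_real ?ltxx.
Qed.

Lemma kd_ge0 l : 0 <= kd l l.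
Proof. by rewrite /kd invr_ge0 subr_ge0 ltW// ball_valP. Qed.

End unit_ball.

Section kernel_vectors.
Context (R : realType) (d : nat).
Implicit Types (l z : unit_ball R d) (Y U H T : hilbertType R).

(* The feature map of the full Fock space: over the words of length [n] the
   inner products sum up to the [n]-th power of [cdot]. *)
Definition monomials Y z (y : Y) : seq 'I_d -> Y :=
  fun w => (\prod_(j <- w) (z 0 j)^*) *: y.

Lemma monomials_words Y z l (y y' : Y) n :
  \sum_(w <- words d n) hdot (monomials z y w) (monomials l y' w) =
  cdot l z ^+ n * hdot y y'.
Proof.
elim: n => [|n IHn] /=.
  by rewrite big_seq1 /monomials !big_nil !scale1r mul1r.
rewrite big_allpairs_dep exprS -mulrA -IHn big_enum /= mulr_suml.
apply: eq_bigr => j _; rewrite mulr_sumr; apply: eq_bigr => w _.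
rewrite /monomials !big_cons !hdotZl !hdotZr !rmorphM /= conjCK; ring.
Qed.

Lemma monomials_partial_dot Y z l (y y' : Y) n :
  partial_dot (monomials z y) (monomials l y') n =
  (1 - cdot l z ^+ n) * (kd l z * hdot y y').
Proof.
rewrite /partial_dot; elim: n => [|n IHn] /=.
  by rewrite big_nil expr0 subrr mul0r.
rewrite big_cat IHn /= monomials_words /kd exprS.
by field; exact: one_sub_cdot_neq0.
Qed.

Lemma monomials_in_fock Y z (y : Y) : monomials z y \in @in_fock R d Y.
Proof.
apply/asboolP; exists (complex.Re (kd z z * hdot y y)) => n.
have h0 : 0 <= kd z z * hdot y y.
  by rewrite mulr_ge0 ?kd_ge0// hnorm_sq lecR sqr_ge0.
rewrite -lecR -partial_dotxx monomials_partial_dot RRe_real ?ger0_real//.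
rewrite -[leRHS]mul1r ler_wpM2r// lerBlDr lerDl exprn_ge0//.
by rewrite -ball_coord_sq lecR; apply: sumr_ge0 => j _; rewrite sqr_ge0.
Qed.

(** [k (z, y)] stands for the function k_z y of H_Y(k_d). The partial sums of a Gram entry are 1 -
    <l, z>^n times the kernel entry, and |<l, z>| < 1. *)
Lemma exists_kernel_vectors Y : exists (T : hilbertType R)
    (k : unit_ball R d * Y -> T),
  cspan (range k) = setT /\
  forall p q, hdot (k p) (k q) = kd q.1 p.1 * hdot p.2 q.2.
Proof.
pose k (p : unit_ball R d * Y) : fock d Y := Fock (monomials_in_fock p.1 p.2).
have [k' [k'E k'T]] := cspan_hspan_gen k; exists (hspan (range k)), k'.
split=> // p q; rewrite k'E.
apply: clim_uniq (fock_hdotP _ _) _.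
have := clim_lin (- (kd q.1 p.1 * hdot p.2 q.2))
  (clim_expr (cdot_lt1 q.1 p.1)) (clim_cst (kd q.1 p.1 * hdot p.2 q.2)).
rewrite mulr0 add0r; congr clim; apply/funext => n.
by rewrite monomials_partial_dot; ring.
Qed.

Section vector_space.
Context (H : hilbertType R) (k : unit_ball R d -> H).
Context (Y T : hilbertType R) (kY : unit_ball R d * Y -> T).
Hypothesis k_total : cspan (range k) = setT.
Hypothesis k_gram : forall z l, hdot (k z) (k l) = kd l z.
Hypothesis kY_total : cspan (range kY) = setT.
Hypothesis kY_gram : forall p q, hdot (kY p) (kY q) = kd q.1 p.1 * hdot p.2 q.2.

Lemma kernel_rkhs : is_rkhs (@kd R d) (fun (f : H) l => hdot f (k l)).
Proof.
split=> [a f g l|f g fg|z]; first exact: hdot_linearl.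
  apply/subr0_eq/(orth_of_total k_total) => _ [l _ <-].
  by rewrite hdotBr !(hdotC (k l)) -(congr1 (@^~ l) fg) subrr.
by exists (k z).
Qed.

(** The family [kY] is abstract, so linearity is read off its Gram matrix: the defect is orthogonal
    to all kernel vectors, which are total. The bound is the square root of [kd l l]. *)
Lemma kernel_blinear l : blinear (fun y => kY (l, y)).
Proof.
split=> [a y y'|].
  apply: subr0_eq; apply: (orth_of_total kY_total) => _ [p _ <-].
  by rewrite hdotBr hdotDr hdotZr !kY_gram /= hdotDr hdotZr; ring.
have [r r0 rE] : exists2 r : R, 0 <= r & kd l l = (r ^+ 2)%:C.
  have := kd_ge0 l; set a := kd l l => a0.
  have aE : a = (complex.Re a)%:C by rewrite RRe_real ?ger0_real.
  have a0' : 0 <= complex.Re a by rewrite -lecR -aE.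
  by exists (Num.sqrt (complex.Re a)); rewrite ?sqrtr_ge0// sqr_sqrtr// -aE.
exists r => // y; rewrite -(@ler_pXn2r _ 2)// ?nnegrE ?mulr_ge0 ?hnorm_ge0//.
by rewrite exprMn -lecR (realCM (r ^+ 2)) -!hnorm_sq kY_gram /= rE.
Qed.

(** The reproducing property <t(l), y> = <t, k_l y>, taken as the definition of point evaluation. *)
Definition kernel_eval (t : T) l : Y := adj (fun y => kY (l, y)) t.

Lemma kernel_evalP t l y : hdot (kernel_eval t l) y = hdot t (kY (l, y)).
Proof. by rewrite -adjP'//; exact: kernel_blinear. Qed.

(** The tensor of f and y is [tau y f], where [tau y] extends k_l |-> k_l y. The two Gram matrices
    differ by the factor |y|^2, which gives the bound; the tensor identities are checked on kernel
    vectors and spread by totality. *)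
Lemma kernel_vector_space :
  is_vector_space_of (fun (f : H) l => hdot f (k l)) kernel_eval.
Proof.
have tauP (y : Y) : exists f : H -> T, blinear f /\ forall l, f (k l) = kY (l, y).
  have bnd n (c : 'I_n -> R[i]) (s : 'I_n -> unit_ball R d) :
      hnorm (\sum_i c i *: kY (s i, y)) <= hnorm y * hnorm (\sum_i c i *: k (s i)).
    rewrite -(@ler_pXn2r _ 2)// ?nnegrE ?mulr_ge0 ?hnorm_ge0//.
    rewrite exprMn -lecR (realCM (hnorm y ^+ 2)).
    rewrite -!hnorm_sq !hdot_suml mulr_sumr le_eqVlt; apply/orP; left; apply/eqP.
    apply: eq_bigr => i _; rewrite !hdotZl !hdot_sumr !mulr_sumr.
    by apply: eq_bigr => j _; rewrite !hdotZr k_gram kY_gram /=; ring.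
  have [f [fL fk _]] := 
    @blinear_extension _ _ _ _ k (fun l => kY (l, y)) _ (hnorm_ge0 y) k_total bnd.
  by exists f.
have [tau tauE] := choice tauP.
have tauL y : blinear (tau y) by case: (tauE y).
have tauk y l : tau y (k l) = kY (l, y) by case: (tauE y).
have tauD f g y y' : hdot (tau y f) (tau y' g) = hdot f g * hdot y y'.
  rewrite (adjP' (tauL y')).
  have -> : adj (tau y') (tau y f) = hdot y y' *: f.
    pose A f := adj (tau y') (tau y f); pose B (f : H) := hdot y y' *: f.
    suff /(congr1 (@^~ f)) : A = B by [].
    apply: (blinear_ext_total _ _ k_total).
    - exact: blinear_comp (adj_blinear (tauL y')) (tauL y).
    - exact: blinear_scale (@blinear_id R H).
    move=> _ [z _ <-]; apply/subr0_eq/(orth_of_total k_total) => _ [l _ <-].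
    by rewrite hdotBr -(adjP (tauL y')) !tauk kY_gram hdotZr k_gram /= -hdotC; ring.
  by rewrite hdotZl mulrC.
have evL l : blinear (kernel_eval ^~ l) by exact: adj_blinear (kernel_blinear l).
split.
- exists (fun f y => tau y f); split.
    split=> [a f g y|a f y y'|f g y y'|].
    + exact: (tauL y).1.
    + pose B f := a *: tau y f + tau y' f.
      suff /(congr1 (@^~ f)) : tau (a *: y + y') = B by [].
      apply: (blinear_ext_total _ _ k_total) => //.
        by apply: blinear_add => //; exact: blinear_scale.
      by move=> _ [l _ <-]; rewrite /B !tauk (kernel_blinear l).1.
    + exact: tauD.
    + apply/seteqP; split=> // t _.
      have : cspan (range kY) t by rewrite kY_total.
      apply: cspan_min; first exact: cspan_closed.
      by move=> _ [[l y] _ <-]; apply: cspan_gen; exists (k l), y; rewrite tauk.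
  move=> f y l; apply: hdot_extl => y'.
  by rewrite kernel_evalP -tauk tauD hdotZl.
- by move=> a s t l; exact: (evL l).1.
- move=> l; have [F FE] := blinear_op (evL l).
  have -> : kernel_eval ^~ l = F by apply/funext => t; rewrite FE.
  exact: op_continuous.
Qed.
End vector_space.

(* The adjoint of the multiplication operator acts on kernel vectors by
   [k_z y |-> k_z (S z)^* y]; the hypothesis makes this a contraction. *)
Lemma multiplier_of_gram (U Y X : hilbertType R) (S : unit_ball R d -> 'L(U, Y))
    (v : unit_ball R d * Y -> X) :
  (forall p q, hdot (v p) (v q) = kd q.1 p.1 *
     (hdot p.2 q.2 - hdot (adj (S p.1) p.2) (adj (S q.1) q.2))) ->
  contractive_multiplier S.
Proof.
move=> vS.
have [H [k0 [k0T k0G]]] := exists_kernel_vectors (complex_line R).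
have [TU [kU [kUT kUG]]] := exists_kernel_vectors U.
have [TY [kY [kYT kYG]]] := exists_kernel_vectors Y.
have k0L l : blinear (fun c => k0 (l, c)) by exact: kernel_blinear.
pose k l := k0 (l, 1 : R[i]).
have kG z l : hdot (k z) (k l) = kd l z.
  rewrite k0G -[hdot _ _]/((1 : R[i]) * (1 : R[i])^*) rmorph1 !mulr1//.
have kT : cspan (range k) = setT.
  apply: total_of_orth => z zk; apply: (orth_of_total k0T) => _ [[l c] _ <-].
  have -> : c = c *: (1 : complex_line R) by rewrite -[RHS]/((c : R[i]) * 1) mulr1.
  rewrite (blinearZ (k0L l)) hdotZl zk ?mulr0//; by exists l.
have rk := kernel_rkhs kT kG.
have vU := kernel_vector_space kT kG kUT kUG.
have vY := kernel_vector_space kT kG kYT kYG.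
exists H, TU, TY, (fun (f : H) l => hdot f (k l)), (kernel_eval kU), (kernel_eval kY).
split=> //.
have bnd n (c : 'I_n -> R[i]) (s : 'I_n -> unit_ball R d * Y) :
    hnorm (\sum_i c i *: kU ((s i).1, adj (S (s i).1) (s i).2)) <=
    1 * hnorm (\sum_i c i *: kY (s i)).
  rewrite mul1r -(@ler_pXn2r _ 2)// ?nnegrE ?hnorm_ge0// -lecR -!hnorm_sq.
  rewrite -subr_ge0.
  (* By the Gram hypothesis, the difference of the squared norms is itself the squared norm of a
     combination of the vectors v. *)
  have -> : hdot (\sum_i c i *: kY (s i)) (\sum_i c i *: kY (s i)) -
     hdot (\sum_i c i *: kU ((s i).1, adj (S (s i).1) (s i).2))
       (\sum_i c i *: kU ((s i).1, adj (S (s i).1) (s i).2)) =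
     hdot (\sum_i c i *: v (s i)) (\sum_i c i *: v (s i)).
    rewrite !hdot_suml -sumrB; apply: eq_bigr => i _.
    rewrite !hdotZl -mulrBr !hdot_sumr -sumrB; congr (_ * _).
    by apply: eq_bigr => j _; rewrite !hdotZr kYG kUG vS /=; ring.
  by rewrite hnorm_sq lecR sqr_ge0.
have [Psi [PL PE Pb]] := 
  @blinear_extension _ _ _ _ kY (fun p => kU (p.1, adj (S p.1) p.2)) _ ler01 kYT bnd.
move=> f; exists (adj Psi f) => [l|].
  apply: hdot_extl => y; rewrite (kernel_evalP kYT kYG) -(adjP' PL) (PE (l, y)).
  by rewrite (adjP (op_blinear (S l))) (kernel_evalP kUT kUG).
by rewrite !hnormE lecR; have := adj_bound PL ler01 Pb f; rewrite mul1r.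
Qed.
End kernel_vectors.

(** * The operator T and its defect *)

Section output_pair.
Context (R : realType) (d : nat) (X Y : hilbertType R).
Context (C : 'L(X, Y)) (A : 'I_d -> 'L(X, X)).
Hypothesis CA_contractive : contractive_pair C A.
Local Notation B := (unit_ball R d).
Implicit Types (l z : B) (p q : B * Y).

Let CL : blinear C. Proof. exact: op_blinear. Qed.
Let AL j : blinear (A j). Proof. exact: op_blinear. Qed.

(** Arbitrary coefficients, unlike [rowZ], since the increment between two points of the ball may
    leave the ball. *)
Definition rowop (h : 'I_d -> R[i]) (p : hpow X d) : X := \sum_j h j *: p j.

Lemma rowop_bound (h : 'I_d -> R[i]) (p : hpow X d) :
  hnorm (rowop h p) <= (\sum_j cnorm (h j)) * hnorm p.
Proof.
rewrite -lecR -hnormE; apply: le_trans (ler_norm_sum _ _ _) _.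
rewrite mulr_suml rmorph_sum /=; apply: ler_sum => j _.
rewrite hnormE lecR hnormZ ler_wpM2l ?cnorm_ge0//.
by rewrite -lecR -!hnormE hpow_norm_ge.
Qed.

Lemma rowop_blinear h : blinear (rowop h).
Proof.
split=> [a p q|]; last first.
  exists (\sum_j cnorm (h j)); last exact: rowop_bound.
  by apply: sumr_ge0 => j _; exact: cnorm_ge0.
rewrite /rowop scaler_sumr -big_split; apply: eq_bigr => j _ /=.
by rewrite !ffunE scalerDr !scalerA mulrC.
Qed.

Definition radius l : R := Num.sqrt (\sum_j cnorm (l 0 j) ^+ 2).

Lemma radius_sq l : radius l ^+ 2 = \sum_j cnorm (l 0 j) ^+ 2.
Proof. by rewrite sqr_sqrtr//; apply: sumr_ge0 => j _; exact: sqr_ge0. Qed.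

Lemma radius_lt1 l : radius l < 1.
Proof.
by rewrite -(@ltr_pXn2r _ 2)// ?nnegrE ?sqrtr_ge0// expr1n radius_sq ball_sq_lt1.
Qed.

Definition colZ l (x : X) : hpow X d := [ffun j => (l 0 j)^* *: x].

Lemma colZ_hnorm l x : hnorm (colZ l x) = radius l * hnorm x.
Proof.
apply/eqP; rewrite -(@eqrXn2 _ 2)// ?mulr_ge0 ?sqrtr_ge0 ?hnorm_ge0//.
rewrite exprMn radius_sq hpow_hnorm mulr_suml; apply/eqP/eq_bigr => j _.
by rewrite ffunE hnormZ cnormC exprMn.
Qed.

Lemma colZ_blinear l : blinear (colZ l).
Proof.
split=> [a x y|]; last first.
  by exists (radius l) => [|x]; rewrite ?sqrtr_ge0// colZ_hnorm.
by apply/ffunP => j; rewrite !ffunE scalerDr !scalerA mulrC.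
Qed.

Lemma adj_rowZ l : adj (rowZ l) = colZ l.
Proof.
apply/funext => x; apply: adj_uniq => p; rewrite hdot_suml hpow_hdot.
by apply: eq_bigr => j _; rewrite ffunE hdotZl hdotZr conjCK.
Qed.

Lemma rowZ_blinear l : blinear (@rowZ R d X l).
Proof. exact: rowop_blinear. Qed.

(** The adjoint column scales norms by exactly [radius l] < 1. The bound of [rowop_bound] is the sum
    of the |l_j|, which may exceed 1 and would not make the resolvent exist. *)
Lemma rowZ_bound l (p : hpow X d) : hnorm (rowZ l p) <= radius l * hnorm p.
Proof.
rewrite -[rowZ l](adjK (rowZ_blinear l)) adj_rowZ.
apply: adj_bound => [||x]; [exact: colZ_blinear|exact: sqrtr_ge0|].
by rewrite colZ_hnorm.
Qed.

Lemma pair_contraction x : hnorm (colA A x) ^+ 2 + hnorm (C x) ^+ 2 <= hnorm x ^+ 2.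
Proof.
have := CA_contractive x; rewrite hdotDl hdot_suml -(adjP' CL) => h.
rewrite -lecR (realCD (hnorm _ ^+ 2)) -!hnorm_sq; apply: le_trans h.
rewrite lerD2r hpow_hdot.
by apply: ler_sum => j _; rewrite ffunE -(adjP' (AL j)).
Qed.

Lemma colA_bound x : hnorm (colA A x) <= hnorm x.
Proof.
rewrite -(@ler_pXn2r _ 2)// ?nnegrE ?hnorm_ge0//; apply: le_trans (pair_contraction x).
by rewrite lerDl sqr_ge0.
Qed.

Lemma C_bound x : hnorm (C x) <= hnorm x.
Proof.
rewrite -(@ler_pXn2r _ 2)// ?nnegrE ?hnorm_ge0//; apply: le_trans (pair_contraction x).
by rewrite lerDr sqr_ge0.
Qed.

Lemma colA_blinear : blinear (colA A).
Proof.
split=> [a x y|]; last by exists 1 => // x; rewrite mul1r colA_bound.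
by apply/ffunP => j; rewrite !ffunE (AL j).1.
Qed.

Lemma adj_colA (p : hpow X d) : adj (colA A) p = \sum_j adj (A j) (p j).
Proof.
apply: adj_uniq => x; rewrite hdot_sumr hpow_hdot.
by apply: eq_bigr => j _; rewrite ffunE (adjP (AL j)).
Qed.

Lemma adj_colA_bound (p : hpow X d) : hnorm (adj (colA A) p) <= hnorm p.
Proof.
rewrite -[leRHS]mul1r; apply: adj_bound => //; first exact: colA_blinear.
by move=> x; rewrite mul1r colA_bound.
Qed.

Definition resolvent l : X -> X := op_inv (fun x => x - rowZ l (colA A x)).

Definition coresolvent z : X -> X :=
  op_inv (fun x => x - adj (colA A) (adj (rowZ z) x)).

Lemma resolventP l : [/\ blinear (resolvent l),
  forall x, resolvent l (x - rowZ l (colA A x)) = x &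
  forall y, resolvent l y - rowZ l (colA A (resolvent l y)) = y].
Proof.
apply: (inverse_of_contraction _ (radius_lt1 l)) => [|x].
  exact: blinear_comp (rowZ_blinear l) colA_blinear.
by apply: le_trans (rowZ_bound _ _) _; rewrite ler_wpM2l ?sqrtr_ge0// colA_bound.
Qed.

Lemma coresolventP l : [/\ blinear (coresolvent l),
  forall x, coresolvent l (x - adj (colA A) (adj (rowZ l) x)) = x &
  forall y, coresolvent l y - adj (colA A) (adj (rowZ l) (coresolvent l y)) = y].
Proof.
apply: (inverse_of_contraction _ (radius_lt1 l)) => [|x].
  apply: blinear_comp; apply: adj_blinear; [exact: colA_blinear|exact: rowZ_blinear].
by apply: le_trans (adj_colA_bound _) _; rewrite adj_rowZ colZ_hnorm.
Qed.

Let resolventVK l y : resolvent l y - rowZ l (colA A (resolvent l y)) = y.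
Proof. by case: (resolventP l). Qed.
Let coresolventVK l y :
  coresolvent l y - adj (colA A) (adj (rowZ l) (coresolvent l y)) = y.
Proof. by case: (coresolventP l). Qed.

Lemma resolvent_adj l x y :
  hdot (resolvent l x) y = hdot x (coresolvent l y).
Proof.
rewrite -{1}(coresolventVK l y) hdotBr -(adjP colA_blinear).
by rewrite -(adjP (rowZ_blinear l)) -hdotBl resolventVK.
Qed.

(** The vector v attached to p = (z, y); [wvec p] and [evec p] are the corresponding w and e. *)
Definition state p : X := coresolvent p.1 (adj C p.2).

Lemma kernel_CA_hdot l z y y' :
  hdot (kernel_CA C A l z y) y' = hdot (state (z, y)) (state (l, y')).
Proof.
have -> : kernel_CA C A l z y = C (resolvent l (coresolvent z (adj C y))).
  rewrite /kernel_CA /resolvent /coresolvent.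
  have -> : (fun x : X => x - \sum_j l 0 j *: A j x) =
      (fun x => x - rowZ l (colA A x)).
    apply/funext => x; congr (x - _); apply: eq_bigr => j _.
    by rewrite ffunE.
  suff -> : (fun x : X => x - \sum_j (z 0 j)^* *: adj (A j) x) =
      (fun x => x - adj (colA A) (adj (rowZ z) x)) by [].
  apply/funext => x; rewrite adj_rowZ adj_colA; congr (x - _).
  by apply: eq_bigr => j _; rewrite ffunE (blinearZ (adj_blinear (AL j))).
by rewrite (adjP CL) resolvent_adj.
Qed.

Lemma spaceD_state p : colZ p.1 (state p) \in in_cspan (spaceD C A).
Proof.
apply/mem_set/cspan_gen; exists p.1, p.2.
by rewrite -adj_rowZ.
Qed.

Definition wvec p : hsum (hspan (spaceD C A)) Y := (HSpan (spaceD_state p), p.2).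

Local Notation DY := (hsum (hspan (spaceD C A)) Y).
Local Notation T := (@opT R d X Y C A).
Local Notation Delta := (@defectT R d X Y C A).

Lemma hspan_val_blinear (H : hilbertType R) (E : set H) :
  blinear (@hspan_val R H E).
Proof. by split=> //; exists 1 => // x; rewrite mul1r hspan_hnorm. Qed.

Lemma hsum_fst_blinear (V W : hilbertType R) : blinear (fun p : hsum V W => p.1).
Proof.
split=> //; exists 1 => // x.
by rewrite mul1r -lecR -!hnormE hsum_norm1.
Qed.

Lemma hsum_snd_blinear (V W : hilbertType R) : blinear (fun p : hsum V W => p.2).
Proof.
split=> //; exists 1 => // x.
by rewrite mul1r -lecR -!hnormE hsum_norm2.
Qed.

Lemma hsum_val_hnorm (H W : hilbertType R) (E : set H) (p : hsum (hspan E) W) :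
  hnorm ((hspan_val p.1, p.2) : hsum H W) = hnorm p.
Proof.
apply: hnorm_eq_sq; apply: etrans (hsum_hnorm _) _.
apply: (etrans _ (esym (hsum_hnorm p))); congr (_ ^+ 2 + _).
exact/esym/hspan_hnorm.
Qed.

Lemma opT_blinear : blinear T.
Proof.
apply: blinear_add.
  apply: (blinear_comp (adj_blinear colA_blinear)).
  exact: blinear_comp (@hspan_val_blinear _ _) (@hsum_fst_blinear _ _).
exact: blinear_comp (adj_blinear CL) (@hsum_snd_blinear _ _).
Qed.

Lemma opT_hdot (p : DY) x : hdot (T p) x =
  hdot ((hspan_val p.1, p.2) : hsum (hpow X d) Y) ((colA A x, C x) : hsum (hpow X d) Y).
Proof.
by rewrite /opT hdotDl -(adjP' colA_blinear) -(adjP' CL) hsum_hdot.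
Qed.

Lemma opT_bound (p : DY) : hnorm (T p) <= hnorm p.
Proof.
apply: hnorm_le_dual => [|x]; first exact: hnorm_ge0.
rewrite opT_hdot -(hsum_val_hnorm p).
apply: le_trans (hnorm_cauchy_schwarz _ _) _; apply: ler_wpM2l.
  exact: hnorm_ge0.
apply: hnorm_le_sq; apply: le_trans (pair_contraction x).
by rewrite le_eqVlt hsum_hnorm eqxx.
Qed.

Lemma adj_opT_opT_bound (p : DY) : hnorm (adj T (T p)) <= hnorm p.
Proof.
apply: le_trans (opT_bound p); rewrite -[leRHS]mul1r.
by apply: adj_bound => //; [exact: opT_blinear|move=> q; rewrite mul1r opT_bound].
Qed.

(** T^* T is a symmetric contraction, so a root of I - T^* T exists; whichever root the choice in
    [op_sqrt] returns then has these properties. *)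
Lemma defectP : [/\ blinear Delta, op_le (fun=> 0) Delta &
  forall r : DY, Delta (Delta r) = r - adj T (T r)].
Proof.
rewrite /defectT /op_sqrt.
have TL := opT_blinear.
have [Q [QL Qpos QQ]] := exists_positive_sqrt (blinear_comp (adj_blinear TL) TL)
  (fun x y => etrans (esym (adjP' TL _ _)) (adjP TL _ _)) adj_opT_opT_bound.
have [F FQ] := blinear_op QL.
case: xgetP => [_ _ [[G ->] Gpos GG]|/(_ Q)[]].
  by split=> //; exact: op_blinear.
by split=> //; exists F; apply/funext.
Qed.

Let DeltaL : blinear Delta. Proof. by case: defectP. Qed.

Lemma defect_symmetric (p q : DY) : hdot (Delta p) q = hdot p (Delta q).
Proof. by case: defectP => DL Dpos _; exact: positive_symmetric. Qed.

Lemma opT_wvec p : T (wvec p) = state p.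
Proof.
rewrite /opT /= -adj_rowZ -{2}[state p]/(coresolvent p.1 (adj C p.2)).
by rewrite addrC -{1}(coresolventVK p.1 (adj C p.2)) subrK.
Qed.

Lemma wvec_hdot p q :
  hdot (wvec p) (wvec q) = cdot q.1 p.1 * hdot (state p) (state q) + hdot p.2 q.2.
Proof.
rewrite hsum_hdot /=; congr (_ + _).
rewrite -[hdot _ _]/(hdot (colZ p.1 (state p)) (colZ q.1 (state q))).
rewrite hpow_hdot /cdot mulr_suml; apply: eq_bigr => j _.
by rewrite !ffunE hdotZl hdotZr conjCK; ring.
Qed.

Lemma defect_wvec_hdot p q : hdot (Delta (wvec p)) (Delta (wvec q)) =
  hdot p.2 q.2 - (1 - cdot q.1 p.1) * hdot (state p) (state q).
Proof.
have [_ _ DD] := defectP.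
rewrite -defect_symmetric DD hdotBl -(adjP' opT_blinear) !opT_wvec wvec_hdot; ring.
Qed.

(** At z = 0 the first component of w vanishes, so a vector orthogonal to all w has zero second
    component; its first component is then orthogonal to the generators of D. *)
Lemma wvec_total : cspan (range wvec) = setT.
Proof.
have zB : cdot (0 : 'rV[R[i]]_d) 0 < 1.
  by rewrite /cdot big1 ?ltr01// => j _; rewrite mxE mul0r.
apply: total_of_orth => -[z1 z2] zP.
have z20 : z2 = 0.
  apply: hdot_ext => y; rewrite hdot0r.
  have /zP : range wvec (wvec (UnitBall zB, y)) by exists (UnitBall zB, y).
  rewrite hsum_hdot /= -[hdot _ z1]/(hdot (colZ (UnitBall zB) _) (hspan_val z1)).
  set x := state _.
  have -> : colZ (UnitBall zB) x = 0.
    by apply/ffunP => j; rewrite !ffunE mxE conjC0 scale0r.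
  by rewrite hdot0l add0r.
have z10 : z1 = 0.
  apply/val_inj/hdot_eq0.
  apply: (@orth_cspan _ _ (spaceD C A)); last by apply/set_mem; case: z1 {zP}.
  move=> _ [z [y ->]].
  have /zP : range wvec (wvec (z, y)) by exists (z, y).
  rewrite hsum_hdot /= z20 hdot0r addr0 => h.
  have -> : adj (rowZ z) (op_inv (fun x => x - adj (colA A) (adj (rowZ z) x))
    (adj C y)) = colZ z (state (z, y)) by rewrite -adj_rowZ.
  exact: h.
by rewrite z10 z20.
Qed.

Lemma evec_subproof p : Delta (wvec p) \in in_cspan (range Delta).
Proof. by apply/mem_set/cspan_gen; exists (wvec p). Qed.

Definition evec p : ran_defect C A := HSpan (evec_subproof p).

Lemma evec_hdot p q : hdot (evec p) (evec q) =
  hdot p.2 q.2 - (1 - cdot q.1 p.1) * hdot (state p) (state q).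
Proof. by rewrite hspan_hdot defect_wvec_hdot. Qed.

(** If z is orthogonal to every Delta w, then Delta z is orthogonal to every w, hence zero; so z is
    orthogonal to the range of Delta, in whose closure it lies. *)
Lemma evec_total : cspan (range evec) = setT.
Proof.
apply: total_of_orth => z zP.
have Dz : Delta (hspan_val z) = 0.
  apply: (orth_of_total wvec_total) => _ [p _ <-]; rewrite -defect_symmetric.
  have /zP : range evec (evec p) by exists p.
  by rewrite hspan_hdot.
apply/val_inj/hdot_eq0.
apply: (@orth_cspan _ _ (range Delta)); last by apply/set_mem; case: z {zP Dz}.
by move=> _ [q _ <-]; rewrite defect_symmetric Dz hdot0r.
Qed.

Lemma kernel_eq_iff_gram (U : hilbertType R) (S : B -> 'L(U, Y)) :
  (forall l z y, kernel_S S l z y = kernel_CA C A l z y) <->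
  (forall p q, hdot (adj (S p.1) p.2) (adj (S q.1) q.2) = hdot (evec p) (evec q)).
Proof.
have kS l z y y' : hdot (kernel_S S l z y) y' =
    kd l z * (hdot y y' - hdot (adj (S z) y) (adj (S l) y')).
  by rewrite hdotZl hdotBl (adjP (op_blinear (S l))).
have kK l z : (1 - cdot l z) * kd l z = 1 by rewrite mulfV// one_sub_cdot_neq0.
split=> [SE [z y] [l y']|SE l z y]; rewrite ?evec_hdot /=.
  rewrite -kernel_CA_hdot -SE kS mulrA kK mul1r; ring.
apply: hdot_extl => y'; rewrite kS kernel_CA_hdot.
rewrite (SE (z, y) (l, y')) evec_hdot /= opprB addrC subrK mulrA.
by rewrite [kd l z * _]mulrC kK mul1r.
Qed.

Lemma hdot_evec (x : ran_defect C A) p :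
  hdot x (evec p) = hdot (hspan_val x) (Delta (wvec p)).
Proof. exact: hspan_hdot. Qed.

(** The adjoint form S(l)^* y = G e: Delta is symmetric, and the row operator of the formula is the
    adjoint of y |-> [wvec (l, y)]. *)
Lemma param_fun_hdot (U : hilbertType R) (G : 'L(ran_defect C A, U)) l u y :
  hdot (param_fun G l u) y = hdot u (G (evec (l, y))).
Proof.
rewrite (adjP' (op_blinear G)) hdot_evec -defect_symmetric /param_fun.
move: (Delta (hspan_val (adj G u))) => p.
rewrite hsum_hdot hdotDl (adjP CL) resolvent_adj; congr (_ + _).
rewrite (adjP (rowZ_blinear l)) adj_rowZ; exact/esym/hspan_hdot.
Qed.

(** Isolates the dependence on l in the form that [realization_analytic] takes. *)
Lemma param_fun_blinear (U : hilbertType R) (G : 'L(ran_defect C A, U)) :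
  exists P Q, [/\ blinear P, blinear Q & forall l u,
    param_fun G l u = C (resolvent l (rowZ l (P u : hpow X d))) + (Q u : Y)].
Proof.
have GL := adj_blinear (op_blinear G).
have DG : blinear (fun u => Delta (hspan_val (adj G u))).
  apply: (blinear_comp DeltaL); apply: blinear_comp GL; exact: hspan_val_blinear.
exists (fun u => hspan_val (Delta (hspan_val (adj G u))).1).
exists (fun u => (Delta (hspan_val (adj G u))).2); split=> //.
  apply: (blinear_comp (@hspan_val_blinear _ _)).
  exact: blinear_comp (@hsum_fst_blinear _ _) DG.
exact: blinear_comp (@hsum_snd_blinear _ _) DG.
Qed.



End output_pair.

(** * Solutions of the kernel identity *)

Section solutions.
Context (R : realType) (d : nat) (X Y U : hilbertType R).
Context (C : 'L(X, Y)) (A : 'I_d -> 'L(X, X)).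
Hypothesis CA_contractive : contractive_pair C A.
Local Notation B := (unit_ball R d).
Implicit Types (l m : B) (S : B -> 'L(U, Y)).

Lemma rowZB l m (p : hpow X d) :
  rowZ m p = rowZ l p + rowop (fun j => m 0 j - l 0 j) p.
Proof.
rewrite /rowZ /rowop -big_split; apply: eq_bigr => j _ /=.
by rewrite scalerBl addrC subrK.
Qed.

(** Applying I - Z(m) A to the difference and substituting x = Z(l) p + Z(l) A x leaves only terms
    with Z(m) - Z(l). *)
Lemma realization_increment l m (p : hpow X d) :
  let h j := m 0 j - l 0 j in
  resolvent A m (rowZ m p) - resolvent A l (rowZ l p) =
  resolvent A m (rowop h (p + colA A (resolvent A l (rowZ l p)))).
Proof.
move=> h; have [mL mK _] := resolventP CA_contractive m.
have [_ _ lVK] := resolventP CA_contractive l.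
set x := resolvent A l _.
rewrite -{1}(mK x) -(blinearB mL); congr (resolvent A m _).
rewrite !(rowZB l m) -/h (blinearD (@rowop_blinear R d X h)).
have := lVK (rowZ l p); rewrite -/x => xE.
rewrite -{1}xE; move: (rowZ l _) (rowop h _) (rowop h _) => a b c.
rewrite opprB [x - a + c]addrC -addrA; congr (c + _).
by rewrite addrA subrKA [x + b]addrC addrK.
Qed.

Lemma resolvent_increment l m g :
  let h j := m 0 j - l 0 j in
  resolvent A m g = resolvent A l g + resolvent A l (rowop h (colA A (resolvent A m g))).
Proof.
move=> h; have [lL lK _] := resolventP CA_contractive l.
have [_ _ mVK] := resolventP CA_contractive m.
set y := resolvent A m g.
rewrite -(blinearD lL) -{1}(lK y); congr (resolvent A l _).
by rewrite -(mVK g) -/y (rowZB l m) opprD addrA subrK.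
Qed.

(** The increment is C R_m h N u, with R the resolvent and h the row of m - l. Replacing R_m by R_l
    gives the derivative; the remainder C R_l h A R_m h N u is quadratic in h. *)
Lemma realization_analytic S (P : U -> hpow X d) (Q : U -> Y) :
  blinear P -> blinear Q ->
  (forall l u, S l u = C (resolvent A l (rowZ l (P u))) + Q u) -> analytic S.
Proof.
move=> PL QL SE l.
have [lL _ _] := resolventP CA_contractive l.
have CL := op_blinear C; have AL := colA_blinear CA_contractive.
pose N u := P u + colA A (resolvent A l (rowZ l (P u))).
have NL : blinear N.
  apply: (blinear_add PL); apply: (blinear_comp AL); apply: (blinear_comp lL).
  exact: blinear_comp (@rowZ_blinear _ _ _ l) PL.
have /choice[D DE] : forall j, exists F : 'L(U, Y), forall u,
    F u = C (resolvent A l (N u j)).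
  move=> j; apply: blinear_op; apply: (blinear_comp CL); apply: (blinear_comp lL).
  have evL : blinear (fun p : hpow X d => p j).
    split=> [a p q|]; first by rewrite !ffunE.
    by exists 1 => // p; rewrite mul1r -lecR -!hnormE hpow_norm_ge.
  exact: blinear_comp evL NL.
have [_ [K0 K00 K0P]] := lL; have [_ [L L0 LP]] := NL.
pose K := K0 + 1; have K1 : 0 < K by rewrite ltr_wpDl.
have KP x : hnorm (resolvent A l x) <= K * hnorm x.
  by apply: le_trans (K0P x) _; rewrite ler_wpM2r ?hnorm_ge0// lerDl.
exists D => _ /pos_realC[e e0 ->].
pose M := 2 * K ^+ 2 * L; have M0 : 0 <= M by rewrite /M !mulr_ge0// ltW.
have M1 : 0 < M + 1 by rewrite ltr_wpDl.
(* The first entry gives K s <= 1/2, which controls R_m near l; the second gives M s <= e, where M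
   s^2 |u| bounds the remainder. *)
pose r := Num.min (2 * K)^-1 (e / (M + 1)).
have r0 : 0 < r by rewrite lt_min invr_gt0 !divr_gt0 ?mulr_gt0.
exists r%:C; first by rewrite ltcR.
move=> m; set h := fun j => m 0 j - l 0 j.
pose s := \sum_j cnorm (h j).
have sE : \sum_j `|m 0 j - l 0 j| = s%:C.
  by rewrite rmorph_sum; apply: eq_bigr => j _; exact: cnormE.
rewrite sE ltcR lt_min => /andP[s1 s2] u.
have s0 : 0 <= s by apply: sumr_ge0 => j _; exact: cnorm_ge0.
have Ks : K * s <= 2^-1.
  have := s1; rewrite -[(2 * K)^-1]mul1r ltr_pdivlMr ?mulr_gt0// => ?; lra.
have Ms : M * s <= e.
  move: s2; rewrite ltr_pdivlMr// => /ltW; apply: le_trans.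
  by rewrite mulrC ler_wpM2l// lerDl.
set g := rowop h (N u); set y := resolvent A m g.
have DS : \sum_j (m 0 j - l 0 j) *: D j u = C (resolvent A l g).
  rewrite /g /rowop (blinear_sum lL) (blinear_sum CL); apply: eq_bigr => j _.
  by rewrite DE (blinearZ lL) (blinearZ CL).
have -> : S m u - S l u - \sum_j (m 0 j - l 0 j) *: D j u =
    C (resolvent A l (rowop h (colA A y))).
  rewrite DS !SE opprD addrACA subrr addr0 -(blinearB CL) realization_increment.
  by rewrite -/h -/(N u) -/g (resolvent_increment l) -/h -(blinearB CL) addrC addKr.
rewrite !hnormE -!rmorphM lecR.
have gb : hnorm g <= s * (L * hnorm u).
  by apply: le_trans (rowop_bound _ _) _; rewrite ler_wpM2l.
have hy x : hnorm (resolvent A l (rowop h (colA A x))) <= K * s * hnorm x.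
  apply: le_trans (KP _) _; rewrite -mulrA ler_wpM2l ?(ltW K1)//.
  apply: le_trans (rowop_bound _ _) _; rewrite ler_wpM2l//.
  exact: colA_bound CA_contractive x.
(* A bound on R_m uniform in m: in y = R_l g + R_l h A y the last term has at most half the norm of
   y and is absorbed. *)
have yb : hnorm y <= 2 * (K * hnorm g).
  have : hnorm y <= hnorm (resolvent A l g) + hnorm (resolvent A l (rowop h (colA A y))).
    by rewrite {1}/y (resolvent_increment l) hnormD.
  have := KP g; have := hy y.
  have : K * s * hnorm y <= 2^-1 * hnorm y by rewrite ler_wpM2r ?hnorm_ge0.
  lra.
apply: le_trans (C_bound CA_contractive _) _; apply: le_trans (hy y) _.
have u0 := hnorm_ge0 u.
apply: (@le_trans _ _ (K * s * (2 * (K * (s * (L * hnorm u)))))).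
  rewrite ler_wpM2l ?mulr_ge0 ?(ltW K1)//; apply: le_trans yb _.
  by rewrite ler_pM2l// ler_pM2l.
have -> : K * s * (2 * (K * (s * (L * hnorm u)))) = M * s * (s * hnorm u).
  by rewrite /M; ring.
by rewrite -[leRHS]mulrA ler_wpM2r// mulr_ge0.
Qed.

Lemma solution_of_param (G : 'L(ran_defect C A, U)) S : isometric G ->
  (forall l u, S l u = param_fun G l u) -> solution C A S.
Proof.
move=> GI SG.
have adjS l y : adj (S l) y = G (evec C A (l, y)).
  by apply: adj_uniq => u; rewrite SG (param_fun_hdot CA_contractive).
have gram p q : hdot (adj (S p.1) p.2) (adj (S q.1) q.2) =
    hdot (evec C A p) (evec C A q).
  rewrite !adjS (isometric_hdot (op_blinear G) GI).
  by case: p q => [? ?] [? ?].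
split; last by apply/(kernel_eq_iff_gram CA_contractive).
split.
  have [P [Q [PL QL PQ]]] := param_fun_blinear CA_contractive G.
  by apply: (realization_analytic PL QL) => l u; rewrite SG PQ.
(* The state vectors factor K_S: solving [evec_hdot] for <v, v'> gives exactly the required Gram
   identity. *)
apply: (@multiplier_of_gram _ _ _ _ X S (state C A)) => p q.
by rewrite gram evec_hdot// /kd; field; exact: one_sub_cdot_neq0.
Qed.

Lemma param_of_solution S : solution C A S ->
  exists2 G : 'L(ran_defect C A, U), isometric G &
    forall l u, S l u = param_fun G l u.
Proof.
move=> [_ /(kernel_eq_iff_gram CA_contractive) gram].
have [f [fL fe fI]] := gram_extension (evec_total CA_contractive) gram.
have [G GE] := blinear_op fL; exists G.
  by move=> x; rewrite GE.
move=> l u; apply: hdot_extl => y.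
by rewrite (param_fun_hdot CA_contractive) GE fe (adjP (op_blinear (S l))).
Qed.

Lemma solution_iff S : solution C A S <->
  exists2 G : 'L(ran_defect C A, U), isometric G &
    forall l u, S l u = param_fun G l u.
Proof.
split=> [|[G GI SG]]; [exact: param_of_solution|exact: solution_of_param SG].
Qed.

Lemma exists_param_solution (G : 'L(ran_defect C A, U)) :
  exists S, forall l u, S l u = param_fun G l u.
Proof.
have [P [Q [PL QL PQ]]] := param_fun_blinear CA_contractive G.
suff /choice[S SE] : forall l, exists F : 'L(U, Y), forall u, F u = param_fun G l u.
  by exists S.
move=> l.
have [lL _ _] := resolventP CA_contractive l.
have [F FE] : exists F : 'L(U, Y), forall u,
    F u = C (resolvent A l (rowZ l (P u))) + Q u.
  apply: blinear_op; apply: blinear_add => //; apply: (blinear_comp (op_blinear C)).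
  by apply: (blinear_comp lL); exact: blinear_comp (@rowZ_blinear _ _ _ l) PL.
by exists F => u; rewrite FE PQ.
Qed.

Lemma eq_param_fun (G G' : 'L(ran_defect C A, U)) l u u' :
  adj G u = adj G' u' -> param_fun G l u = param_fun G' l u'.
Proof. by rewrite /param_fun => ->. Qed.

(** The parameters correspond through W = G0 G^* and, conversely, G = W^* G0. *)
Lemma unitary_params (G0 : 'L(ran_defect C A, U)) S0 S : unitary G0 ->
  (forall l u, S0 l u = param_fun G0 l u) ->
  (exists2 G : 'L(ran_defect C A, U), unitary G &
     forall l u, S l u = param_fun G l u) <->
  (exists2 W : 'L(U, U), unitary W & forall l u, S l u = S0 l (W u)).
Proof.
move=> G0U S0E; have G0L := op_blinear G0; have [G0I G0O] := G0U.
split=> [[G GU SE]|[W WU SE]].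
  have GL := op_blinear G; have [GI GO] := GU.
  have [W WE] := blinear_op (blinear_comp G0L (adj_blinear GL)).
  exists W => [|l u].
    split=> [u|y].
      by have [x <-] := GO u; rewrite WE (isometric_adjK GL GI) G0I GI.
    by have [x <-] := G0O y; exists (G x); rewrite WE (isometric_adjK GL GI).
  rewrite SE S0E; apply: eq_param_fun.
  by rewrite WE (isometric_adjK G0L G0I).
have WL := op_blinear W; have [WI WO] := WU.
have WK := unitary_adjK WL WU.
have [G GE] := blinear_op (blinear_comp (adj_blinear WL) G0L).
exists G => [|l u].
  split=> [x|u].
    by rewrite -WI GE WK G0I.
  have [x xE] := G0O (W u); exists x.
  by rewrite GE xE (isometric_adjK WL WI).
rewrite SE S0E; apply: eq_param_fun; apply/esym/adj_uniq => x.
by rewrite GE -(adjP' WL) (adjP G0L).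
Qed.

End solutions.

Theorem theorem2p11 (R : realType) (d : nat) (X Y U : hilbertType R)
    (C : 'L(X, Y)) (A : 'I_d -> 'L(X, X)) (CA_contractive : contractive_pair C A) :
  [/\ (exists S : unit_ball R d -> 'L(U, Y), solution C A S)
        <-> hdim_le (ran_defect C A) U,
      hdim_le (ran_defect C A) U ->
        forall S : unit_ball R d -> 'L(U, Y), solution C A S <->
          exists2 G : 'L(ran_defect C A, U), isometric G
            & forall l u, S l u = param_fun G l u
      (* Solutions with a non-surjective G exist in infinite dimension; they differ
         from those with a unitary G by a factor that is not unitary. *)
    & hdim_eq (ran_defect C A) U ->
        (hdim_finite U ->
           unique_up_to_right_unitary (fun S : unit_ball R d -> 'L(U, Y) =>
             solution C A S)) /\
        unique_up_to_right_unitary (fun S : unit_ball R d -> 'L(U, Y) =>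
          solution C A S /\
          exists2 G : 'L(ran_defect C A, U), unitary G
            & forall l u, S l u = param_fun G l u)].
Proof.
have solE := @solution_iff R d X Y U C A CA_contractive.
split=> [|_|DU]; last 1 first.
- have [G0 G0U] := unitary_of_hdim_eq DU.
  have [S0 S0E] := exists_param_solution CA_contractive G0.
  have S0sol : solution C A S0 by apply/solE; exists G0; [case: G0U|].
  have uni S := unitary_params S G0U S0E.
  split=> [Ufin|]; exists S0 => //.
  (* In finite dimension every isometric parameter is unitary, so all solutions are of the form
     covered by [uni]. *)
  + move=> S; rewrite -uni solE; split=> -[G GI SE]; exists G => //.
      by apply: (finite_isometry_unitary DU) => //; exact: op_blinear.
    by case: GI.
  + by split=> //; exists G0.
  + move=> S; rewrite -uni; split=> [[]//|[G GU SE]]; split; last by exists G.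
    by apply/solE; exists G; [case: GU|].
- split=> [[S /solE[G GI _]]|/isometry_of_hdim_le[G GI]].
    exact: hdim_le_of_isometry (op_blinear G) GI.
  have [S SE] := exists_param_solution CA_contractive G.
  by exists S; apply/solE; exists G.
- exact: solE.
Qed.
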